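(* Let $n\geq 1$ and $k\geq 2$ be integers, and let $w$ be a length-$n$ word over $\Sigma_k$. Then $\operatorname{rankB}_k(w)$ can be computed (from $w$ and $k$) in $O(kn^3)$ time using $O(n)$ space, under the unit-cost RAM model.
   Context: $\Sigma_k=\{1,2,\ldots,k\}$ with $1<2<\cdots<k$, and $\Sigma_k^n$ is the set of length-$n$ words over $\Sigma_k$. Lexicographic order: for $x=x_1\cdots x_m$ and $y=y_1\cdots y_n$, $x<y$ if $x$ is a proper prefix of $y$, or if $x_i<y_i$ for the smallest $i$ with $x_i\neq y_i$. A border of a word $w$ is a word that is both a non-empty proper prefix and a non-empty proper suffix of $w$; $w$ is bordered if it has a border and unbordered otherwise. $\operatorname{rankB}_k(w)$ denotes the rank (position, starting from $1$) of $w$ in the lexicographic listing of all bordered words of length $|w|$ over $\Sigma_k$; for an arbitrary word $w$ of length $n$ this is taken to mean $1$ plus the number of length-$n$ bordered words over $\Sigma_k$ that are lexicographically smaller than $w$. Unit-cost RAM model: integer variables use constant space and integer arithmetic operations take constant time. *)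

(* Defs.v *)
From Stdlib Require Import ZArith.
From mathcomp Require Import all_boot.
Set Implicit Arguments. Unset Strict Implicit. Unset Printing Implicit Defensive.

Definition word_over (k : nat) (w : seq nat) : bool :=
  all (fun a => (1 <= a <= k)%N) w.

Definition bordered (w : seq nat) : bool :=
  [exists i : 'I_(size w), (0 < i)%N && (take i w == drop (size w - i) w)].

Fixpoint lexlt (x y : seq nat) : bool :=
  match x, y with
  | [::], [::] => false
  | [::], _ :: _ => true
  | _ :: _, [::] => false
  | a :: x', b :: y' => (a < b)%N || ((a == b) && lexlt x' y')
  end.

(* letter i : 'I_k  represents the letter i+1 of Sigma_k *)
Definition word_of (n k : nat) (v : n.-tuple 'I_k) : seq nat :=
  [seq (val i).+1 | i <- v].

Definition rankB (k : nat) (w : seq nat) : nat :=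
  (#|[pred v : (size w).-tuple 'I_k |
       bordered (word_of v) && lexlt (word_of v) w]|).+1.

(* Registers indexed by nat, each holding an unbounded integer (Z).    *)
(* Each instruction costs one time unit; arithmetic on registers is     *)
(* constant time.  Space = number of registers 0..m where m is the      *)
(* largest register address accessed during the run.                   *)

Inductive instr : Type :=
| IConst of nat & Z
| IAdd of nat & nat & nat
| ISub of nat & nat & nat
| IMul of nat & nat & nat
| IDiv of nat & nat & nat      (* r[d] := r[a] / r[b]  (floor; 0 if r[b]=0) *)
| ILoad of nat & nat
| IStore of nat & nat
| IJz of nat & nat
| IJneg of nat & nat
| IJmp of nat
| IHalt.

Definition program := seq instr.
Definition memory := nat -> Z.
Definition config := (nat * memory)%type.

Definition upd (m : memory) (d : nat) (z : Z) : memory :=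
  fun i => if i == d then z else m i.

(* one step; None means the machine has halted
   (Halt instruction, or program counter outside the program) *)
Definition step (P : program) (c : config) : option config :=
  let: (pc, m) := c in
  match nth IHalt P pc with
  | IConst d z => Some (pc.+1, upd m d z)
  | IAdd d a b => Some (pc.+1, upd m d (m a + m b)%Z)
  | ISub d a b => Some (pc.+1, upd m d (m a - m b)%Z)
  | IMul d a b => Some (pc.+1, upd m d (m a * m b)%Z)
  | IDiv d a b => Some (pc.+1, upd m d (m a / m b)%Z)
  | ILoad d a => Some (pc.+1, upd m d (m (Z.to_nat (m a))))
  | IStore a s => Some (pc.+1, upd m (Z.to_nat (m a)) (m s))
  | IJz r l => Some (if (m r =? 0)%Z then l else pc.+1, m)
  | IJneg r l => Some (if (m r <? 0)%Z then l else pc.+1, m)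
  | IJmp l => Some (l, m)
  | IHalt => None
  end.

Definition touched (P : program) (c : config) : nat :=
  let: (pc, m) := c in
  match nth IHalt P pc with
  | IConst d _ => d
  | IAdd d a b | ISub d a b | IMul d a b | IDiv d a b => maxn d (maxn a b)
  | ILoad d a => maxn d (maxn a (Z.to_nat (m a)))
  | IStore a s => maxn a (maxn s (Z.to_nat (m a)))
  | IJz r _ | IJneg r _ => r
  | IJmp _ | IHalt => 0
  end.

Fixpoint exec (P : program) (t : nat) (c : config) : option (config * nat) :=
  match t with
  | 0 => if step P c is None then Some (c, 0) else None
  | t'.+1 =>
      match step P c with
      | None => None
      | Some c' =>
          match exec P t' c' with
          | None => None
          | Some (cf, mx) => Some (cf, maxn (touched P c) mx)
          end
      end
  end.

(* Input convention: r[0] = k, r[1] = n = |w|, r[i+2] = w_i (0-based),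
   all other registers 0; program counter 0.  Output: r[0] at halt. *)
Definition init_mem (k : nat) (w : seq nat) : memory :=
  fun i => match i with
           | 0 => Z.of_nat k
           | 1 => Z.of_nat (size w)
           | j.+2 => if (j < size w)%N then Z.of_nat (nth 0 w j) else 0%Z
           end.

Definition init_config (k : nat) (w : seq nat) : config := (0, init_mem k w).

(* Main.v *)
Require Import Defs.
From Stdlib Require Import ZArith.
From mathcomp Require Import all_boot zify.

(** Shift letters to digits, so that the words below [w] are counted by the
    base-[k] value of [w]; it remains to subtract the unbordered ones.  A word
    is below [w] iff it extends exactly one prefix [p = w_1 ... w_i d] with
    [d < w_(i+1)], so it suffices to count, for each of these at most [k n]
    prefixes, the unbordered words of length [n] that extend [p], in time
    [O(n^2)].  Let [f N] be the number of unbordered words of length [N]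
    compatible with [p] (one is a prefix of the other).  A bordered word has a
    unique unbordered border, its shortest one, of length [j <= N / 2]; hence
    [k ^ (N - |p|) = f N + sum_(1 <= j <= N / 2) f j * c N j], where [c N j] is
    a power of [k], or 0 or 1 according to whether [p] overlaps itself.  With
    unit-cost arithmetic the overlap is tested in constant time by comparing
    base-[k] values of factors of [p], obtained from those of its prefixes.
    The resulting nest of four loops is analysed in a loop language with arrays
    of natural numbers, where variables and arrays cannot alias; a compiler to
    the RAM preserves its exact cost. *)

Set Implicit Arguments.
Unset Strict Implicit.
Unset Printing Implicit Defensive.

(** * Words over the alphabet {0, ..., k - 1} *)

Definition words (k N : nat) : seq (seq nat) :=
  [seq [seq val i | i <- tval v] | v <- enum {: N.-tuple 'I_k}].

Lemma words_uniq k N : uniq (words k N).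
Proof.
by rewrite map_inj_uniq ?enum_uniq // => u v /(inj_map val_inj)/val_inj.
Qed.

Lemma mem_words k N u : (u \in words k N) = (size u == N) && all (ltn^~ k) u.
Proof.
apply/mapP/andP => [[v _ ->]|[/eqP su /allP ku]].
  by rewrite size_map size_tuple; split=> //; apply/allP => x /mapP[i _ ->] /=.
have sv : size (pmap (insub : nat -> option 'I_k) u) == N.
  rewrite size_pmap_sub -su -all_count; exact/allP.
exists (Tuple sv); first by rewrite mem_enum.
rewrite /= pmap_filter; last by move=> x; exact: insubK.
apply/esym/all_filterP/allP => x /ku kx.
by rewrite /isSome insubT.
Qed.

Lemma size_words k N : size (words k N) = k ^ N.
Proof. by rewrite size_map -cardE card_tuple card_ord. Qed.

Lemma card_words k N (P : pred (seq nat)) :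
  #|[pred v : N.-tuple 'I_k | P [seq val i | i <- v]]| = count P (words k N).
Proof.
rewrite -sum1_count big_map big_enum_cond -sum1_card.
by apply: eq_bigl => v; rewrite inE.
Qed.

Lemma all_take (T : Type) (a : pred T) i s : all a s -> all a (take i s).
Proof. by rewrite -{1}(cat_take_drop i s) all_cat => /andP[]. Qed.

Lemma all_drop (T : Type) (a : pred T) i s : all a s -> all a (drop i s).
Proof. by rewrite -{1}(cat_take_drop i s) all_cat => /andP[]. Qed.

Lemma words_cat k i j :
  perm_eq (words k (i + j)) [seq u ++ v | u <- words k i, v <- words k j].
Proof.
apply: uniq_perm; first exact: words_uniq.
  apply: allpairs_uniq; rewrite ?words_uniq // => -[u v] [u' v'].
  move=> /allpairsP[[a b] [au _ [-> ->]]] /allpairsP[[c d] [cu _ [-> ->]]] /= /eqP.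
  move: au cu; rewrite !mem_words => /andP[/eqP sa _] /andP[/eqP sc _].
  by rewrite eqseq_cat ?sa ?sc // => /andP[/eqP -> /eqP ->].
move=> w; rewrite mem_words; apply/andP/allpairsP => [[/eqP sw kw]|[[u v] [/= uu vv ->]]].
  exists (take i w, drop i w); rewrite !mem_words size_drop size_takel sw ?leq_addr //.
  by rewrite eqxx addKn eqxx all_take ?all_drop ?cat_take_drop.
move: uu vv; rewrite !mem_words size_cat all_cat => /andP[/eqP -> ->] /andP[/eqP -> ->].
by rewrite eqxx.
Qed.

Lemma count_words_cat k i j (P Q : pred (seq nat)) :
  count (fun w => P (take i w) && Q (drop i w)) (words k (i + j)) =
  count P (words k i) * count Q (words k j).
Proof.
rewrite (permP (words_cat k i j)) -[LHS]sum1_count big_mkcond big_allpairs_dep /=.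
rewrite -[count P _]sum1_count big_distrl /= [RHS]big_mkcond; apply: eq_big_seq => u.
rewrite mem_words => /andP[/eqP su _].
under eq_bigr => v _ do rewrite take_size_cat // drop_size_cat //.
case: (P u) => /=; last by rewrite big1.
by rewrite mul1n -[count Q _]sum1_count [RHS]big_mkcond.
Qed.

(** * Borders *)

Definition border_at (j : nat) (v : seq nat) : bool :=
  take j v == drop (size v - j) v.

Lemma border_atP j v : j <= size v ->
  reflect (forall x, x < j -> nth 0 v x = nth 0 v (size v - j + x))
          (border_at j v).
Proof.
move=> j_le; apply: (iffP eqP) => [eq_border x xj|eq_border].
  by rewrite -nth_drop -eq_border nth_take.
apply: (@eq_from_nth _ 0); first by rewrite size_takel // size_drop; lia.
by move=> x; rewrite size_takel // => xj; rewrite nth_take // nth_drop eq_border.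
Qed.

Lemma borderedP v :
  reflect (exists2 j, 0 < j < size v & border_at j v) (bordered v).
Proof.
apply: (iffP existsP) => [[i /andP[i0 border_i]]|[j /andP[j0 j_le] border_j]].
  by exists (i : nat) => //; rewrite i0 ltn_ord.
by exists (Ordinal j_le); rewrite j0.
Qed.

Lemma border_at_take i j v : i <= j -> j <= size v -> border_at j v ->
  border_at i (take j v) = border_at i v.
Proof.
move=> ij j_le /eqP border_j; rewrite /border_at size_takel // take_takel //.
by rewrite {1}border_j drop_drop; congr (_ == drop _ _); lia.
Qed.

Lemma bordered_take i j v : 0 < i < j -> j <= size v ->
  border_at i v -> border_at j v -> bordered (take j v).
Proof.
move=> /andP[i0 ij] j_le border_i border_j; apply/borderedP; exists i.
  by rewrite size_takel ?i0.
by rewrite border_at_take // ltnW.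
Qed.

(* The occurrences of the border at both ends overlap in a word of length 2j - |v|. *)
Lemma border_at_overlap j v : j <= size v -> border_at j v ->
  border_at (j + j - size v) v.
Proof.
move=> j_le /(border_atP j_le) shift; apply/border_atP; first lia.
move=> x xj; rewrite shift; last lia.
by rewrite shift; [congr (nth _ _ _)|]; lia.
Qed.

Lemma shortest_border v : bordered v ->
  exists2 j, 0 < j <= (size v)./2 & border_at j v && ~~ bordered (take j v).
Proof.
move=> /borderedP bordered_v.
have ex : exists j, (0 < j < size v) && border_at j v.
  by have [j j_range border_j] := bordered_v; exists j; rewrite j_range.
case: (ex_minnP ex) => j /andP[/andP[j0 j_le] border_j] minj.
exists j; last first.
  rewrite border_j; apply/borderedP => -[i].
  rewrite size_takel ?(ltnW j_le) // => /andP[i0 ij].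
  rewrite border_at_take ?(ltnW ij) ?(ltnW j_le) // => border_i.
  by have := minj i; rewrite i0 border_i (ltn_trans ij j_le) leqNgt ij => /(_ isT).
rewrite j0 leqNgt; apply/negP => long.
by have := minj (j + j - size v); rewrite border_at_overlap ?(ltnW j_le) // andbT; lia.
Qed.

Lemma unbordered_border_inj i j v :
  0 < i <= size v -> border_at i v -> ~~ bordered (take i v) ->
  0 < j <= size v -> border_at j v -> ~~ bordered (take j v) -> i = j.
Proof.
wlog: i j / i <= j => [sym|].
  by case: (leqP i j) => [|/ltnW] ij *; [|apply/esym]; apply: sym.
rewrite leq_eqVlt => /predU1P[//|ij] /andP[i0 _] border_i _ /andP[_ j_le] border_j /negP[].
by apply: bordered_take border_i border_j; rewrite ?i0.
Qed.

Lemma bordered_sum v :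
  (bordered v : nat) =
  \sum_(1 <= j < (size v)./2.+1) (border_at j v && ~~ bordered (take j v)).
Proof.
case: (boolP (bordered v)) => [bordered_v|unbordered_v]; last first.
  rewrite big_nat big1 // => j j_range; case: (boolP (border_at j v)) => //= border_j.
  by case/borderedP: unbordered_v; exists j => //; lia.
have [j j_range border_j] := shortest_border bordered_v.
rewrite (bigD1_seq j) ?iota_uniq ?mem_index_iota //= border_j big_seq_cond big1 // => i.
rewrite mem_index_iota => /andP[i_range ij]; apply/eqP; rewrite eqb0.
apply: contra ij => /andP[border_i unbordered_i].
case/andP: border_j => border_j unbordered_j; apply/eqP.
by apply: (unbordered_border_inj _ border_i _ _ border_j) => //; lia.
Qed.

Lemma words_border k N j : j + j <= N ->
  perm_eq [seq v <- words k N | border_at j v]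
          [seq u ++ take j u | u <- words k (N - j)].
Proof.
move=> jN; apply: uniq_perm; first exact/filter_uniq/words_uniq.
  rewrite map_inj_in_uniq ?words_uniq // => u v.
  rewrite !mem_words => /andP[/eqP su _] /andP[/eqP sv _] /eqP.
  by rewrite eqseq_cat ?su ?sv // => /andP[/eqP].
move=> v; rewrite mem_filter mem_words.
apply/and3P/mapP => [[/eqP border_v /eqP sv kv]|[u + ->]].
  exists (take (N - j) v).
    by rewrite mem_words size_takel ?sv ?eqxx ?all_take //; lia.
  by rewrite take_takel ?border_v ?sv ?cat_take_drop //; lia.
rewrite mem_words => /andP[/eqP su ku]; have ju : j <= size u by lia.
rewrite /border_at size_cat size_takel // addnK drop_size_cat // takel_cat // eqxx.
by rewrite all_cat ku all_take //; split=> //; rewrite su subnK; lia.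
Qed.

Lemma count_border_at k N j (P : pred (seq nat)) : j + j <= N ->
  count (fun v => border_at j v && P v) (words k N) =
  count (fun u => P (u ++ take j u)) (words k (N - j)).
Proof.
move=> jN; rewrite -[RHS]count_map -(permP (words_border k jN)) count_filter.
by apply: eq_count => v; rewrite andbC.
Qed.

(** * Counting the unbordered words compatible with a prefix *)

Definition compat (p v : seq nat) : bool := take (size p) v == take (size v) p.

Lemma compat_long p v : size p <= size v -> compat p v = (take (size p) v == p).
Proof. by move=> pv; rewrite /compat (take_oversize pv). Qed.

Lemma compat_short p v : size v <= size p -> compat p v = (v == take (size v) p).
Proof. by move=> pv; rewrite /compat (take_oversize pv). Qed.

Lemma compat_cat p u v : compat p (u ++ v) = compat p u && compat (drop (size u) p) v.
Proof.
case: (leqP (size p) (size u)) => pu.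
  rewrite /compat (drop_oversize pu) /= take0 eqxx andbT takel_cat //.
  by rewrite (take_oversize pu) [take (size (u ++ v)) p]take_oversize // size_cat; lia.
rewrite [compat p u]compat_short ?(ltnW pu) // /compat size_cat takeD.
rewrite take_cat ltnNge (ltnW pu) /= eqseq_cat ?size_takel ?(ltnW pu) //.
by rewrite size_drop.
Qed.

Lemma count_compat k p N : all (ltn^~ k) p ->
  count (compat p) (words k N) = k ^ (N - size p).
Proof.
move=> kp; case: (leqP (size p) N) => pN.
  transitivity (count (fun v => (take (size p) v == p) && predT (drop (size p) v))
                  (words k (size p + (N - size p)))).
    rewrite subnKC //; apply: eq_in_count => v.
    by rewrite mem_words andbT => /andP[/eqP sv _]; rewrite compat_long ?sv.
  rewrite (count_words_cat _ _ _ (pred1 p)) count_predT size_words.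
  by rewrite count_uniq_mem ?words_uniq // mem_words eqxx kp mul1n.
have -> : N - size p = 0 by lia.
transitivity (count_mem (take N p) (words k N)).
  apply: eq_in_count => v; rewrite mem_words => /andP[/eqP sv _].
  by rewrite compat_short sv // ltnW.
by rewrite count_uniq_mem ?words_uniq // mem_words size_takel ?eqxx ?all_take // ltnW.
Qed.

Definition unbordered_count (k : nat) (p : seq nat) (N : nat) : nat :=
  count (fun v => ~~ bordered v && compat p v) (words k N).

Lemma unbordered_count_short k p N : all (ltn^~ k) p -> N <= size p ->
  unbordered_count k p N = ~~ bordered (take N p).
Proof.
move=> kp Np; rewrite /unbordered_count; case: (boolP (bordered _)) => bp /=.
  apply/eqP; rewrite -leqn0 leqNgt -has_count; apply/hasPn => v.
  rewrite mem_words => /andP[/eqP sv _]; rewrite compat_short sv //.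
  by apply/andP => -[+ /eqP Ev]; rewrite Ev bp.
transitivity (count (compat p) (words k N)); last by rewrite count_compat // (eqP Np).
apply: eq_in_count => v; rewrite mem_words => /andP[/eqP sv _].
by rewrite compat_short ?sv //; case: eqP => [->|_]; rewrite ?bp ?andbF.
Qed.

(* The number of ways to complete an unbordered word b of length j, compatible
   with p, to a word of length N that is compatible with p and has the border b. *)
Definition border_completions (k : nat) (p : seq nat) (N j : nat) : nat :=
  if N - j < size p then nat_of_bool (compat (drop (N - j) p) (take j p))
  else k ^ (N - j - maxn (size p) j).

Lemma count_border k p N j : all (ltn^~ k) p -> j + j <= N ->
  count (fun v => border_at j v && (compat p v && ~~ bordered (take j v))) (words k N) =
  unbordered_count k p j * border_completions k p N j.
Proof.
move=> kp jN; rewrite count_border_at // /border_completions; case: ltnP => overlap.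
  have jp : j <= size p by lia.
  rewrite unbordered_count_short // mulnb.
  transitivity (count (fun u => (compat p u) && (~~ bordered (take j p)
      && compat (drop (N - j) p) (take j p))) (words k (N - j))).
    apply: eq_in_count => u; rewrite mem_words => /andP[/eqP su _].
    have ju : j <= size u by lia.
    rewrite compat_cat takel_cat // su compat_short ?su ?(ltnW overlap) //.
    case: eqP => //= Eu; rewrite Eu take_takel //; last by lia.
    by rewrite andbC.
  case: (_ && _); last by under eq_count do rewrite andbF; rewrite count_pred0.
  by under eq_count do rewrite andbT; rewrite count_compat // (eqP (ltnW overlap)).
transitivity (count (fun u => (~~ bordered (take j u) && compat p (take j u))
    && compat (drop j p) (drop j u)) (words k (j + (N - j - j)))).
  have -> : j + (N - j - j) = N - j by lia.
  apply: eq_in_count => u; rewrite mem_words => /andP[/eqP su _].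
  have ju : j <= size u by lia.
  rewrite compat_cat takel_cat // su (drop_oversize overlap) {2}/compat take0 andbT.
  by rewrite -{1}(cat_take_drop j u) compat_cat size_takel // andbC andbA.
rewrite (count_words_cat _ _ _ (fun u => ~~ bordered u && compat p u)).
by rewrite count_compat ?all_drop // size_drop; congr (_ * _ ^ _); lia.
Qed.

Lemma unbordered_count_rec k p N : all (ltn^~ k) p ->
  unbordered_count k p N +
  \sum_(1 <= j < N./2.+1) unbordered_count k p j * border_completions k p N j =
  k ^ (N - size p).
Proof.
move=> kp; rewrite -(count_compat N kp).
have -> : \sum_(1 <= j < N./2.+1) unbordered_count k p j * border_completions k p N j =
    count (fun v => bordered v && compat p v) (words k N).
  transitivity (\sum_(1 <= j < N./2.+1) \sum_(v <- words k N)
      (border_at j v && (compat p v && ~~ bordered (take j v)) : nat)).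
    apply: eq_big_nat => j j_range; rewrite -count_border //; last lia.
    by rewrite -sum1_count big_mkcond.
  rewrite exchange_big -sum1_count [RHS]big_mkcond /=; apply: eq_big_seq => v.
  rewrite mem_words => /andP[/eqP <- _].
  case: (compat p v); rewrite ?andbF ?andbT /=.
    by rewrite -bordered_sum; case: bordered.
  by rewrite big1 // => j _; rewrite andbF.
rewrite /unbordered_count -!sum1_count [RHS](bigID bordered) /= addnC.
by congr (_ + _); apply: eq_bigl => v; rewrite andbC.
Qed.

(** * Base-k values and the rank *)

Definition digits_val (k : nat) (u : seq nat) : nat :=
  foldl (fun a d => a * k + d) 0 u.

Lemma digits_val_rcons k u d : digits_val k (rcons u d) = digits_val k u * k + d.
Proof. by rewrite /digits_val foldl_rcons. Qed.

Lemma digits_val_cat k u v :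
  digits_val k (u ++ v) = digits_val k u * k ^ size v + digits_val k v.
Proof.
elim/last_ind: v => [|v d IH]; first by rewrite cats0 muln1 addn0.
by rewrite -rcons_cat !digits_val_rcons IH size_rcons expnS; nia.
Qed.

Lemma digits_val_inj k u v : all (ltn^~ k) u -> all (ltn^~ k) v ->
  size u = size v -> digits_val k u = digits_val k v -> u = v.
Proof.
elim/last_ind: u v => [|u a IH] v; first by case: v.
case/lastP: v => [|v b]; first by rewrite size_rcons.
rewrite !all_rcons !size_rcons !digits_val_rcons => /andP[ak ku] /andP[bk kv] [suv] eq_val.
have k0 : 0 < k by case: (k) ak.
have eq_ab : a = b by have := congr1 (modn^~ k) eq_val; rewrite /= !modnMDl !modn_small.
rewrite eq_ab in eq_val *; congr rcons; apply: IH => //.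
by apply/eqP; rewrite -(eqn_pmul2r k0) -(eqn_add2r b) eq_val.
Qed.

Lemma compat_drop_take_digits_val k p s j : all (ltn^~ k) p -> j <= s < size p ->
  let e := minn (s + j) (size p) in
  compat (drop s p) (take j p) =
  (digits_val k (take e p) ==
   digits_val k (take s p) * k ^ (e - s) + digits_val k (take (e - s) p)).
Proof.
move=> kp /andP[js sp] e; rewrite /compat size_drop size_takel; last lia.
have -> : take (size p - s) (take j p) = take (e - s) p.
  by rewrite -take_min; congr take; lia.
have -> : take j (drop s p) = drop s (take e p).
  by rewrite take_drop addnC /e take_min take_size.
have sd : size (drop s (take e p)) = e - s by rewrite size_drop size_takel //; lia.
rewrite -[in RHS](cat_take_drop s (take e p)) take_takel; last lia.
rewrite digits_val_cat sd eqn_add2l; apply/eqP/eqP => [->//|eq_val].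
apply: (@digits_val_inj k); rewrite ?all_drop ?all_take //.
by rewrite sd size_takel //; lia.
Qed.

Lemma compat_letter a b u v : compat (a :: u) (b :: v) = (a == b) && compat u v.
Proof. by rewrite /compat /= eqseq_cons eq_sym. Qed.

Lemma ltn_sum a b : (a < b : nat) = \sum_(0 <= d < b) (d == a).
Proof.
elim: b => [|b IH]; first by rewrite big_geq.
by rewrite big_nat_recr //= -IH ltnS; case: (ltngtP a b).
Qed.

Lemma lexlt_sum u v : size v = size u ->
  (lexlt v u : nat) =
  \sum_(0 <= i < size u) \sum_(0 <= d < nth 0 u i) compat (rcons (take i u) d) v.
Proof.
elim: u v => [|b u IH] [|a v] //=; first by rewrite big_nil.
case=> suv; rewrite big_nat_recl //=.
under eq_bigr => d _ do rewrite compat_letter /compat take0 andbT.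
rewrite -ltn_sum; under eq_bigr => i _ do under eq_bigr => d _ do rewrite compat_letter.
case: (eqVneq a b) => [->|ab]; rewrite ?ltnn /=.
  by rewrite IH // eqxx.
rewrite big1 => [|i _]; first by rewrite addn0 orbF.
by rewrite big1 // => d _; rewrite eq_sym (negbTE ab).
Qed.

Lemma count_lexlt k u (P : pred (seq nat)) :
  count (fun v => P v && lexlt v u) (words k (size u)) =
  \sum_(0 <= i < size u) \sum_(0 <= d < nth 0 u i)
    count (fun v => P v && compat (rcons (take i u) d) v) (words k (size u)).
Proof.
transitivity (\sum_(v <- words k (size u)) \sum_(0 <= i < size u)
    \sum_(0 <= d < nth 0 u i) (P v && compat (rcons (take i u) d) v)); last first.
  rewrite exchange_big /=; apply: eq_bigr => i _.
  rewrite exchange_big /=; apply: eq_bigr => d _.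
  by rewrite -sum1_count [RHS]big_mkcond.
rewrite -sum1_count big_mkcond /=; apply: eq_big_seq => v.
rewrite mem_words => /andP[/eqP sv _].
case: (P v) => /=; first by rewrite -lexlt_sum //; case: lexlt.
by rewrite big1 // => i _; rewrite big1.
Qed.

Lemma digits_val_sum k u :
  digits_val k u = \sum_(0 <= i < size u) nth 0 u i * k ^ (size u - i.+1).
Proof.
elim: u => [|a u IH]; first by rewrite big_nil.
rewrite -cat1s digits_val_cat big_nat_recl //= IH subSS subn0.
by congr (_ + _); apply: eq_bigr => i _; rewrite subSS.
Qed.

Lemma count_lexlt_words k u : all (ltn^~ k) u ->
  count (lexlt^~ u) (words k (size u)) = digits_val k u.
Proof.
move=> ku; rewrite (count_lexlt k u predT) digits_val_sum.
apply: eq_big_nat => i i_range.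
rewrite -[X in X * _]subn0 -sum_nat_const_nat; apply: eq_big_nat => d d_range.
have uik : nth 0 u i < k by apply: (allP ku); rewrite mem_nth.
rewrite count_compat; last by rewrite all_rcons all_take // andbT /=; lia.
by rewrite size_rcons size_takel // ltnW.
Qed.

Lemma bordered_map (f : nat -> nat) u : injective f ->
  bordered [seq f x | x <- u] = bordered u.
Proof.
move=> fI; apply/borderedP/borderedP; rewrite size_map => -[j j_range border_j];
  exists j => //.
  by move: border_j; rewrite /border_at size_map -map_take -map_drop (inj_eq (inj_map fI)).
by rewrite /border_at size_map -map_take -map_drop (inj_eq (inj_map fI)).
Qed.

Lemma lexlt_map_succn u v : lexlt (map succn u) (map succn v) = lexlt u v.
Proof. by elim: u v => [|a u IH] [|b v] //=; rewrite IH ltnS eqSS. Qed.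

Lemma rankB_map_succn k u :
  rankB k (map succn u) =
  (count (fun v => bordered v && lexlt v u) (words k (size u))).+1.
Proof.
rewrite /rankB size_map -card_words; congr S; apply: eq_card => v; rewrite !inE.
have -> : word_of v = map succn [seq val i | i <- v] by rewrite /word_of -map_comp.
by rewrite bordered_map ?lexlt_map_succn //; exact: succn_inj.
Qed.

Lemma rankB_unbordered_count k u : all (ltn^~ k) u ->
  rankB k (map succn u) =
  (digits_val k u - \sum_(0 <= i < size u) \sum_(0 <= d < nth 0 u i)
     unbordered_count k (rcons (take i u) d) (size u)).+1.
Proof.
move=> ku; rewrite rankB_map_succn -(count_lexlt_words ku) /unbordered_count.
rewrite -(count_lexlt k u (predC bordered)); congr S; rewrite -!sum1_count.
rewrite [X in _ = X - _](bigID bordered) /=.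
under [X in _ = _ + X - _]eq_bigl do rewrite andbC.
by rewrite addnK; apply: eq_bigl => v; rewrite andbC.
Qed.

(** * Running RAM code *)

Definition code_at (P : program) (pc : nat) (c : seq instr) : Prop :=
  forall i, i < size c -> nth IHalt P (pc + i) = nth IHalt c i.

Lemma code_at_cat P pc c1 c2 : code_at P pc (c1 ++ c2) ->
  code_at P pc c1 /\ code_at P (pc + size c1) c2.
Proof.
move=> code; split=> i lt_i.
  by rewrite code ?nth_cat ?lt_i // size_cat; lia.
rewrite -addnA code ?size_cat ?ltn_add2l // nth_cat ifF; last by lia.
by congr (nth _ _ _); lia.
Qed.

Lemma code_at_cons P pc i c :
  code_at P pc (i :: c) -> nth IHalt P pc = i /\ code_at P pc.+1 c.
Proof.
move=> code; split; first by have := code 0 isT; rewrite addn0.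
by move: code; rewrite -cat1s => /code_at_cat[_]; rewrite addn1.
Qed.

Fixpoint reach (P : program) (S t : nat) (c c' : config) : Prop :=
  if t is t'.+1 then
    touched P c <= S /\ exists2 c1, step P c = Some c1 & reach P S t' c1 c'
  else c = c'.

Lemma reach_trans P S t1 t2 c c1 c2 :
  reach P S t1 c c1 -> reach P S t2 c1 c2 -> reach P S (t1 + t2) c c2.
Proof.
elim: t1 c => [|t1 IH] c /=; first by move=> ->.
by move=> [tS [c' st r1]] r2; split=> //; exists c' => //; exact: IH.
Qed.

Lemma reach_step P S c c' : touched P c <= S -> step P c = Some c' -> reach P S 1 c c'.
Proof. by move=> tS st; split=> //; exists c'. Qed.

Lemma reach_exec P S t c c' : reach P S t c c' -> step P c' = None ->
  exists2 mx, mx <= S & exec P t c = Some (c', mx).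
Proof.
elim: t c => [|t IH] c /=; first by move=> -> ->; exists 0.
move=> [tS [c1 -> /IH r]] /r[mx mxS ->].
by exists (maxn (touched P c) mx); rewrite // geq_max tS.
Qed.

Lemma reach_loop P S start exit N (time : nat -> nat) last
    (I : nat -> memory -> Prop) (Q : memory -> Prop) :
  (forall i m, i < N -> I i m ->
     exists2 m', reach P S (time i) (start, m) (start, m') & I i.+1 m') ->
  (forall m, I N m -> exists2 m', reach P S last (start, m) (exit, m') & Q m') ->
  forall m, I 0 m -> exists2 m',
    reach P S (\sum_(0 <= i < N) time i + last) (start, m) (exit, m') & Q m'.
Proof.
move=> iteration leave m I0.
have [m1 r1 /leave[m2 r2 Qm2]] : exists2 m1,
    reach P S (\sum_(0 <= i < N) time i) (start, m) (start, m1) & I N m1.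
  elim: N iteration {leave} => [|N IH] iteration; first by exists m; rewrite ?big_geq.
  have [i m1 iN|m1 r1 /iteration[//|m2 r2 I2]] := IH; first exact/iteration/ltnW.
  by exists m2 => //; rewrite big_nat_recr //; exact: reach_trans r1 r2.
by exists m2 => //; exact: reach_trans r1 r2.
Qed.

Definition is_jump (i : instr) : bool :=
  match i with IJz _ _ | IJneg _ _ | IJmp _ | IHalt => true | _ => false end.

Definition effect (i : instr) (m : memory) : memory :=
  if step [:: i] (0, m) is Some (_, m') then m' else m.

Definition run_block (c : seq instr) (m : memory) : memory :=
  foldl (fun m i => effect i m) m c.

Fixpoint block_fits (S : nat) (c : seq instr) (m : memory) : bool :=
  if c is i :: c' then
    [&& ~~ is_jump i, touched [:: i] (0, m) <= S & block_fits S c' (effect i m)]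
  else true.

Lemma run_block_cat c1 c2 m : run_block (c1 ++ c2) m = run_block c2 (run_block c1 m).
Proof. exact: foldl_cat. Qed.

Lemma block_fits_cat S c1 c2 m :
  block_fits S (c1 ++ c2) m = block_fits S c1 m && block_fits S c2 (run_block c1 m).
Proof. by elim: c1 m => [|i c1 IH] m //=; rewrite IH !andbA. Qed.

Lemma reach_block P S c pc m : code_at P pc c -> block_fits S c m ->
  reach P S (size c) (pc, m) (pc + size c, run_block c m).
Proof.
elim: c pc m => [|i c IH] pc m /=; first by rewrite addn0.
move=> /code_at_cons[Ei code] /and3P[ji tS /(IH _ _ code) r]; rewrite Ei addnS -addSn.
split; first by case: (i) ji tS.
by exists (pc.+1, effect i m) => //; rewrite /effect; case: (i) ji.
Qed.

Lemma upd_same m d z : upd m d z d = z.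
Proof. by rewrite /upd eqxx. Qed.

Lemma upd_other m d z x : x != d -> upd m d z x = m x.
Proof. by rewrite /upd => /negbTE ->. Qed.

Ltac simpl_upd := repeat first [rewrite upd_same | rewrite upd_other; last by lia].

(** * A loop language over the natural numbers *)

(* A location is a variable [inl x], which lives at index 0, or an array [inr a]. *)
Definition location := (nat + nat)%type.
Definition store := location -> nat -> nat.

Definition set (s : store) (l : location) (i v : nat) : store :=
  fun l' i' => if (l' == l) && (i' == i) then v else s l' i'.

Local Notation var s x := (s (inl x) 0%N).
Local Notation cell s a i := (s (inr a) i).
Local Notation set_var s x v := (set s (inl x) 0%N v).
Local Notation set_cell s a i v := (set s (inr a) i v).

Inductive binop : Type := Plus | Minus | Times | Quot.

Inductive expr : Type :=
| Cst of nat
| Var of nat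
| Get of nat & expr
| Bin of binop & expr & expr
| Cond of expr & expr & expr.

Definition eval_binop (o : binop) (x y : nat) : nat :=
  match o with Plus => x + y | Minus => x - y | Times => x * y | Quot => x %/ y end.

Fixpoint eval (s : store) (e : expr) : nat :=
  match e with
  | Cst v => v
  | Var x => var s x
  | Get a e => cell s a (eval s e)
  | Bin o e f => eval_binop o (eval s e) (eval s f)
  | Cond e f g => if 0 < eval s e then eval s f else eval s g
  end.

Fixpoint reads (e : expr) : seq location :=
  match e with
  | Cst _ => [::]
  | Var x => [:: inl x]
  | Get a e => inr a :: reads e
  | Bin _ e f => reads e ++ reads f
  | Cond e f g => reads e ++ reads f ++ reads g
  end.

Inductive cmd : Type :=
| Assign of nat & expr
| Put of nat & expr & expr
| Seq of cmd & cmd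
| For of nat & expr & expr & cmd.

Definition incr (x : nat) (s : store) : store := set_var s x (var s x).+1.

Fixpoint run (c : cmd) (s : store) : store :=
  match c with
  | Assign x e => set_var s x (eval s e)
  | Put a i e => set_cell s a (eval s i) (eval s e)
  | Seq c1 c2 => run c2 (run c1 s)
  | For x lo hi b =>
      iter (eval s hi - eval s lo) (fun s' => incr x (run b s'))
           (set_var s x (eval s lo))
  end.

Fixpoint writes (c : cmd) : seq location :=
  match c with
  | Assign x _ => [:: inl x]
  | Put a _ _ => [:: inr a]
  | Seq c1 c2 => writes c1 ++ writes c2
  | For x _ _ b => inl x :: writes b
  end.

Definition loop_state (x : nat) (lo : expr) (b : cmd) (s : store) (i : nat) : store :=
  iter i (fun s' => incr x (run b s')) (set_var s x (eval s lo)).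

Definition agree_off (L : seq location) (s s' : store) : Prop :=
  forall l, l \notin L -> s' l =1 s l.

Lemma agree_off_trans L s1 s2 s3 :
  agree_off L s1 s2 -> agree_off L s2 s3 -> agree_off L s1 s3.
Proof. by move=> agree12 agree23 l lL i; rewrite agree23 ?agree12. Qed.

Lemma agree_off_sub (L L' : seq location) s s' :
  {subset L <= L'} -> agree_off L s s' -> agree_off L' s s'.
Proof. by move=> LL' agree l lL'; apply: agree; apply: contra lL' => /LL'. Qed.

Lemma agree_off_set (L : seq location) s l i v : l \in L -> agree_off L s (set s l i v).
Proof. by move=> lL l' l'L j; rewrite /set; case: eqP l'L => // ->; rewrite lL. Qed.

Lemma loop_state_agree_off x lo b s i :
  (forall s', agree_off (writes b) s' (run b s')) ->
  agree_off (inl x :: writes b) s (loop_state x lo b s i).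
Proof.
move=> agree_b; elim: i => [|i IH] /=; first by apply: agree_off_set; rewrite inE eqxx.
apply: (agree_off_trans IH); apply: (@agree_off_trans _ _ (run b _)).
  by apply: agree_off_sub (agree_b _) => l; rewrite inE orbC => ->.
by apply: agree_off_set; rewrite inE eqxx.
Qed.

Lemma run_agree_off c s : agree_off (writes c) s (run c s).
Proof.
elim: c s => [x e|a i e|c1 IH1 c2 IH2|x lo hi b IH] s /=.
- by apply: agree_off_set; rewrite inE.
- by apply: agree_off_set; rewrite inE.
- apply: (@agree_off_trans _ _ (run c1 s)).
    by apply: agree_off_sub (IH1 s) => l; rewrite mem_cat => ->.
  by apply: agree_off_sub (IH2 _) => l; rewrite mem_cat orbC => ->.
- exact: loop_state_agree_off.
Qed.

Lemma loop_state_index x lo b s i : inl x \notin writes b ->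
  var (loop_state x lo b s i) x = eval s lo + i.
Proof.
move=> xb; rewrite /loop_state; elim: i => [|i IH].
  by rewrite /= /set !eqxx addn0.
by rewrite iterS {1}/incr /set !eqxx run_agree_off // IH addnS.
Qed.

Lemma eval_agree s s' e : {in reads e, forall l, s' l =1 s l} -> eval s' e = eval s e.
Proof.
elim: e => [v|x|a e IH|o e IHe f IHf|e IHe f IHf g IHg] //= agree.
- by rewrite agree ?inE.
- by rewrite agree ?IH ?inE ?eqxx // => l le; apply: agree; rewrite inE le orbT.
- by rewrite IHe ?IHf // => l rl; apply: agree; rewrite mem_cat rl ?orbT.
- by rewrite IHe ?IHf ?IHg // => l rl; apply: agree; rewrite !mem_cat rl ?orbT.
Qed.

(** * Compilation to the RAM *)

Lemma Z_truncated_sub (x y : nat) :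
  ((Z.of_nat x - Z.of_nat y) *
   ((Z.of_nat x - Z.of_nat y) / (Z.of_nat x + Z.of_nat y + 1) + 1))%Z = Z.of_nat (x - y).
Proof.
case: (leqP y x) => xy; first by rewrite Z.div_small; lia.
rewrite -(Z.div_unique_pos _ _ (- 1) (Z.of_nat x + Z.of_nat x + 1)); lia.
Qed.

Lemma Z_of_nat_divn (x y : nat) : Z.of_nat (x %/ y) = (Z.of_nat x / Z.of_nat y)%Z.
Proof.
case: y => [|y]; first by rewrite divn0 Zdiv_0_r.
apply: (@Z.div_unique_pos _ _ _ (Z.of_nat (x %% y.+1))).
  by have := ltn_pmod x (ltn0Sn y); lia.
by rewrite {1}(divn_eq x y.+1); lia.
Qed.

Lemma Z_select (x y z : nat) :
  (Z.of_nat x / Z.of_nat x * (Z.of_nat y - Z.of_nat z) + Z.of_nat z)%Z =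
  Z.of_nat (if 0 < x then y else z).
Proof. by case: x => [|x] //=; rewrite Z.div_same; lia. Qed.

(* Register 2 holds the distance 32 n between consecutive arrays, the other
   registers below 16 hold the variables, and registers 16, ..., 31 form an
   evaluation stack. Array 0 is the memory itself. Cells have indices up to n + 1
   in arrays 0, ..., 4, so that 130 n bounds all addresses. *)
Local Notation stride := 2 (only parsing).
Local Notation stack := 16 (only parsing).
Local Notation nregs := 32 (only parsing).

Definition is_variable (x : nat) : bool := (x < stack) && (x != stride).

Section Compilation.

Variable n : nat.
Hypothesis n_gt0 : 0 < n.

Definition address (a i : nat) : nat := nregs * n * a + i.

Definition valid_cell (a i : nat) : bool :=
  [&& a <= 4, i <= n.+1 & (0 < a) || (nregs <= i)].

Lemma address_inj a i b j : valid_cell a i -> valid_cell b j ->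
  (address a i == address b j) = (a == b) && (i == j).
Proof.
move=> /and3P[_ i_n _] /and3P[_ j_n _].
apply/idP/andP => [/eqP eq_addr|[/eqP -> /eqP ->]] //.
have index_small l : l <= n.+1 -> l < nregs * n by lia.
have stride_gt0 : 0 < nregs * n by lia.
have := congr1 (divn^~ (nregs * n)) eq_addr; have := congr1 (modn^~ (nregs * n)) eq_addr.
rewrite /address /= ![nregs * n * _]mulnC !modnMDl !divnMDl //.
rewrite !modn_small ?index_small //.
by rewrite !divn_small ?index_small // !addn0 => -> ->.
Qed.

Lemma address_bounds a i : valid_cell a i -> nregs <= address a i <= 130 * n.
Proof.
rewrite /address => /and3P[a4 i_n pos].
have na4 : n * a <= n * 4 by rewrite leq_mul2l a4 orbT.
case/orP: pos => [a0|i32]; last by lia.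
have na1 : n * 1 <= n * a by rewrite leq_mul2l a0 orbT.
by lia.
Qed.

Definition represents (s : store) (m : memory) : Prop :=
  [/\ m stride = Z.of_nat (nregs * n),
      forall x, is_variable x -> m x = Z.of_nat (var s x) &
      forall a i, valid_cell a i -> m (address a i) = Z.of_nat (cell s a i)].

Definition same_below (d : nat) (m m' : memory) : Prop :=
  forall x, (x < d) || (nregs <= x) -> m' x = m x.

Lemma same_below_trans d d' m1 m2 m3 : d <= d' ->
  same_below d m1 m2 -> same_below d' m2 m3 -> same_below d m1 m3.
Proof. by move=> dd' same12 same23 x xd; rewrite same23 ?same12 //; lia. Qed.

Lemma same_below_upd d x m z : d <= x < nregs -> same_below d m (upd m x z).
Proof. by move=> xd y yd; rewrite upd_other //; lia. Qed.

Lemma represents_same_below s d m m' : stack <= d ->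
  same_below d m m' -> represents s m -> represents s m'.
Proof.
move=> d16 same [m_stride m_var m_cell]; split=> [|x vx|a i ai].
- by rewrite same //; lia.
- by rewrite same ?m_var //; move: vx; rewrite /is_variable; lia.
- by rewrite same ?m_cell //; have := address_bounds ai; lia.
Qed.

Lemma represents_set_var s m x v : is_variable x ->
  represents s m -> represents (set_var s x v) (upd m x (Z.of_nat v)).
Proof.
rewrite /is_variable => vx [m_stride m_var m_cell]; split=> [|y vy|a i ai].
- by rewrite upd_other //; lia.
- rewrite /set eqxx andbT; case: (eqVneq y x) => [->|yx].
    by rewrite upd_same eqxx.
  by rewrite upd_other ?m_var // ifN.
- by rewrite upd_other ?m_cell //; have := address_bounds ai; lia.
Qed.

Lemma represents_set_cell s m a i v : valid_cell a i -> represents s m ->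
  represents (set_cell s a i v) (upd m (address a i) (Z.of_nat v)).
Proof.
move=> ai [m_stride m_var m_cell]; have addr := address_bounds ai.
split=> [|y vy|b j bj].
- by rewrite upd_other //; lia.
- by rewrite upd_other ?m_var //; move: vy; rewrite /is_variable; lia.
- rewrite /upd /set address_inj // (_ : (inr b == inr a :> location) = (b == a)) //.
  by case: ifP => // _; exact: m_cell.
Qed.

Definition compile_address (d a : nat) : seq instr :=
  [:: IConst d.+1 (Z.of_nat a); IMul d.+1 d.+1 stride; IAdd d d d.+1].

Definition compile_binop (d : nat) (o : binop) : seq instr :=
  match o with
  | Plus => [:: IAdd d d d.+1]
  (* floor((x - y) / (x + y + 1)) is -1 if x < y, and 0 otherwise *)
  | Minus =>
      [:: IAdd d.+2 d d.+1; IConst d.+3 1; IAdd d.+2 d.+2 d.+3; ISub d d d.+1;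
          IDiv d.+1 d d.+2; IAdd d.+1 d.+1 d.+3; IMul d d d.+1]
  | Times => [:: IMul d d d.+1]
  | Quot => [:: IDiv d d d.+1]
  end.

(* x / x is the truth value of 0 < x, since 0 / 0 = 0 *)
Definition compile_select (d : nat) : seq instr :=
  [:: IDiv d d d; ISub d.+1 d.+1 d.+2; IMul d d d.+1; IAdd d d d.+2].

Fixpoint compile_expr (d : nat) (e : expr) : seq instr :=
  match e with
  | Cst v => [:: IConst d (Z.of_nat v)]
  | Var x => [:: IConst d 0; IAdd d d x]
  | Get a e => compile_expr d e ++ compile_address d a ++ [:: ILoad d d]
  | Bin o e f => compile_expr d e ++ compile_expr d.+1 f ++ compile_binop d o
  | Cond e f g =>
      compile_expr d e ++ compile_expr d.+1 f ++ compile_expr d.+2 g ++ compile_select d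
  end.

Fixpoint expr_fits (d : nat) (e : expr) : bool :=
  match e with
  | Cst _ => d < nregs
  | Var x => is_variable x && (d < nregs)
  | Get _ e => expr_fits d e && (d.+1 < nregs)
  | Bin _ e f => [&& expr_fits d e, expr_fits d.+1 f & d.+3 < nregs]
  | Cond e f g =>
      [&& expr_fits d e, expr_fits d.+1 f, expr_fits d.+2 g & d.+2 < nregs]
  end.

Fixpoint safe_expr (s : store) (e : expr) : bool :=
  match e with
  | Cst _ | Var _ => true
  | Get a e => safe_expr s e && valid_cell a (eval s e)
  | Bin _ e f => safe_expr s e && safe_expr s f
  (* both branches are evaluated *)
  | Cond e f g => [&& safe_expr s e, safe_expr s f & safe_expr s g]
  end.

Lemma safe_expr_agree s s' e : {in reads e, forall l, s' l =1 s l} ->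
  safe_expr s' e = safe_expr s e.
Proof.
elim: e => [v|x|a e IH|o e IHe f IHf|e IHe f IHf g IHg] //= agree.
- have agree_e : {in reads e, forall l, s' l =1 s l}.
    by move=> l le; apply: agree; rewrite inE le orbT.
  by rewrite IH ?(eval_agree agree_e).
- by rewrite IHe ?IHf // => l rl; apply: agree; rewrite mem_cat rl ?orbT.
- by rewrite IHe ?IHf ?IHg // => l rl; apply: agree; rewrite !mem_cat rl ?orbT.
Qed.

Definition computes (d : nat) (c : seq instr) (v : nat) (m : memory) : Prop :=
  [/\ block_fits (130 * n) c m, run_block c m d = Z.of_nat v &
      same_below d m (run_block c m)].

Lemma computes_nil d v m : m d = Z.of_nat v -> computes d [::] v m.
Proof. by move=> md; split. Qed.

Lemma computes_cons d i c v m : ~~ is_jump i ->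
  touched [:: i] (0, m) <= 130 * n -> same_below d m (effect i m) ->
  computes d c v (effect i m) -> computes d (i :: c) v m.
Proof.
move=> ji tS same_i [fit_c c_d same_c]; split=> //=; first by rewrite ji tS.
exact: same_below_trans same_i same_c.
Qed.

Lemma computes_cat d d' c1 c2 v w m : d <= d' -> computes d' c1 v m ->
  (forall m', m' d' = Z.of_nat v -> same_below d' m m' -> computes d c2 w m') ->
  computes d (c1 ++ c2) w m.
Proof.
move=> dd' [fit1 v1 same1] /(_ _ v1 same1)[fit2 v2 same2].
rewrite /computes block_fits_cat run_block_cat fit1; split=> // x xd.
by rewrite same2 // same1 //; lia.
Qed.

Lemma computes_cat2 s d c1 c2 c v1 v2 v m : stack <= d -> represents s m ->
  (forall m', represents s m' -> computes d c1 v1 m') ->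
  (forall m', represents s m' -> computes d.+1 c2 v2 m') ->
  (forall m', represents s m' -> m' d = Z.of_nat v1 -> m' d.+1 = Z.of_nat v2 ->
     computes d c v m') ->
  computes d (c1 ++ c2 ++ c) v m.
Proof.
move=> d16 repr_m comp1 comp2 comp; apply: (computes_cat (leqnn d) (comp1 _ repr_m)).
move=> m1 m1_d same1; have repr_m1 := represents_same_below d16 same1 repr_m.
apply: (computes_cat (leqnSn d) (comp2 _ repr_m1)) => m2 m2_d same2.
apply: comp => //; last by rewrite same2 // leqnn.
exact: (represents_same_below (leqW d16) same2).
Qed.

Ltac compute_instr := apply: computes_cons;
  [by [] | rewrite /touched /=; lia | by apply: same_below_upd; lia | rewrite /effect /=].

Lemma computes_address d a i m : stack <= d -> d.+1 < nregs ->
  m stride = Z.of_nat (nregs * n) -> m d = Z.of_nat i ->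
  computes d (compile_address d a) (address a i) m.
Proof.
move=> d16 d32 m_stride m_d; do 3 compute_instr; apply: computes_nil; simpl_upd.
by rewrite /address; lia.
Qed.

Lemma computes_load d p v m : d < nregs <= p -> p <= 130 * n ->
  m d = Z.of_nat p -> m p = Z.of_nat v -> computes d [:: ILoad d d] v m.
Proof.
move=> dp pS md mp; apply: computes_cons => //.
- by rewrite /touched /= md Nat2Z.id; lia.
- by apply: same_below_upd; lia.
- by apply: computes_nil; rewrite /effect /= upd_same md Nat2Z.id.
Qed.

Lemma computes_binop d o x y m : d.+3 < nregs ->
  m d = Z.of_nat x -> m d.+1 = Z.of_nat y ->
  computes d (compile_binop d o) (eval_binop o x y) m.
Proof.
move=> d32 m_x m_y; case: o.
- by compute_instr; apply: computes_nil; simpl_upd; rewrite m_x m_y /=; lia.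
- by do 7 compute_instr; apply: computes_nil; simpl_upd; rewrite m_x m_y Z_truncated_sub.
- by compute_instr; apply: computes_nil; simpl_upd; rewrite m_x m_y /=; lia.
- by compute_instr; apply: computes_nil; simpl_upd; rewrite m_x m_y /= Z_of_nat_divn.
Qed.

Lemma computes_select d x y z m : d.+2 < nregs ->
  m d = Z.of_nat x -> m d.+1 = Z.of_nat y -> m d.+2 = Z.of_nat z ->
  computes d (compile_select d) (if 0 < x then y else z) m.
Proof.
move=> d32 m_x m_y m_z; do 4 compute_instr; apply: computes_nil; simpl_upd.
by rewrite m_x m_y m_z Z_select.
Qed.

Lemma compile_exprP s e d m : stack <= d -> expr_fits d e -> safe_expr s e ->
  represents s m -> computes d (compile_expr d e) (eval s e) m.
Proof.
move=> d16 fits safe; move: m; elim: e d d16 fits safe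
  => [v|x|a e IH|o e IHe f IHf|e IHe f IHf g IHg] d d16 /=.
- by move=> d32 _ m _; compute_instr; apply: computes_nil; simpl_upd.
- move=> /andP[vx d32] _ m [_ m_var _]; move: (vx); rewrite /is_variable => x16.
  by do 2 compute_instr; apply: computes_nil; simpl_upd; rewrite m_var.
- move=> /andP[fe d32] /andP[se ai] m repr_m.
  apply: (computes_cat (leqnn d) (IH _ d16 fe se m repr_m)) => m1 m1_d same1.
  have repr_m1 := represents_same_below d16 same1 repr_m; have [m1_stride _ _] := repr_m1.
  have /andP[lo hi] := address_bounds ai.
  apply: (computes_cat (leqnn d) (computes_address a d16 d32 m1_stride m1_d)).
  move=> m2 m2_d same2; apply: (computes_load _ hi m2_d).
    by rewrite (ltn_trans _ d32).
  by have [_ _] := represents_same_below d16 same2 repr_m1; apply.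
- move=> /and3P[fe ff d32] /andP[se sf] m repr_m.
  apply: (computes_cat2 d16 repr_m (IHe _ d16 fe se) (IHf _ (leqW d16) ff sf)) => m' _.
  exact: computes_binop.
- move=> /and4P[fe ff fg d32] /and3P[se sf sg] m repr_m.
  apply: (computes_cat2 d16 repr_m (IHe _ d16 fe se) (IHf _ (leqW d16) ff sf)).
  move=> m1 repr_m1 m1_e m1_f.
  apply: (computes_cat (leqW (leqnSn d)) (IHg _ (leqW (leqW d16)) fg sg _ repr_m1)).
  by move=> m2 m2_g same2; apply: computes_select => //; rewrite same2 //; lia.
Qed.

Lemma size_compile_expr d e : size (compile_expr d e) = size (compile_expr 0 e).
Proof.
elim: e d => //= [a e IH|o e IHe f IHf|e IHe f IHf g IHg] d.
- by rewrite !size_cat IH.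
- by rewrite !size_cat IHe IHf [size (compile_expr 1 f)]IHf; case: o.
- rewrite !size_cat IHe IHf [size (compile_expr 1 f)]IHf IHg.
  by rewrite [size (compile_expr 2 g)]IHg.
Qed.

Definition expr_cost (e : expr) : nat := size (compile_expr 0 e).

Definition compile_assign (x : nat) (e : expr) : seq instr :=
  compile_expr stack e ++ [:: IConst stack.+1 0; IAdd x stack stack.+1].

Definition compile_put (a : nat) (i e : expr) : seq instr :=
  compile_expr stack e ++ (compile_expr stack.+1 i ++ compile_address stack.+1 a) ++
  [:: IStore stack.+1 stack].

Definition compile_test (x : nat) (hi : expr) (body exit : nat) : seq instr :=
  compile_expr stack hi ++ [:: ISub stack x stack; IJneg stack body; IJmp exit].

Definition compile_incr (x start : nat) : seq instr :=
  [:: IConst stack 1; IAdd x x stack; IJmp start].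

Fixpoint compile (c : cmd) (pc : nat) : seq instr :=
  match c with
  | Assign x e => compile_assign x e
  | Put a i e => compile_put a i e
  | Seq c1 c2 => compile c1 pc ++ compile c2 (pc + size (compile c1 pc))
  | For x lo hi b =>
      let start := pc + (expr_cost lo + 2) in
      let body := start + (expr_cost hi + 3) in
      let exit := body + (size (compile b body) + 3) in
      compile_assign x lo ++ compile_test x hi body exit ++
      compile b body ++ compile_incr x start
  end.

Lemma size_compile_assign x e : size (compile_assign x e) = expr_cost e + 2.
Proof. by rewrite size_cat size_compile_expr. Qed.

Lemma size_compile_put a i e :
  size (compile_put a i e) = expr_cost i + expr_cost e + 4.
Proof.
rewrite !size_cat (size_compile_expr stack) (size_compile_expr stack.+1) /expr_cost /=.
by lia.
Qed.

Lemma size_compile_test x hi body exit :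
  size (compile_test x hi body exit) = expr_cost hi + 3.
Proof. by rewrite size_cat size_compile_expr. Qed.

Fixpoint cmd_fits (c : cmd) : bool :=
  match c with
  | Assign x e => is_variable x && expr_fits stack e
  | Put _ i e => expr_fits stack e && expr_fits stack.+1 i
  | Seq c1 c2 => cmd_fits c1 && cmd_fits c2
  | For x lo hi b =>
      [&& is_variable x, expr_fits stack lo, expr_fits stack hi, cmd_fits b,
          inl x \notin reads hi & all [predC writes b] (inl x :: reads hi)]
  end.

Fixpoint safe (c : cmd) (s : store) : Prop :=
  match c with
  | Assign _ e => safe_expr s e
  | Put a i e => [&& safe_expr s i, safe_expr s e & valid_cell a (eval s i)]
  | Seq c1 c2 => safe c1 s /\ safe c2 (run c1 s)
  | For x lo hi b =>
      [/\ safe_expr s lo, safe_expr s hi &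
          forall i, i < eval s hi - eval s lo -> safe b (loop_state x lo b s i)]
  end.

Fixpoint cost (c : cmd) (s : store) : nat :=
  match c with
  | Assign _ e => expr_cost e + 2
  | Put _ i e => expr_cost i + expr_cost e + 4
  | Seq c1 c2 => cost c1 s + cost c2 (run c1 s)
  | For x lo hi b =>
      expr_cost lo + 2 +
      (\sum_(0 <= i < eval s hi - eval s lo)
          (expr_cost hi + 2 + (cost b (loop_state x lo b s i) + 3)) + (expr_cost hi + 3))
  end.

Definition simulates (c : cmd) (s : store) : Prop :=
  forall P pc m, code_at P pc (compile c pc) -> represents s m ->
  exists2 m', reach P (130 * n) (cost c s) (pc, m) (pc + size (compile c pc), m') &
    represents (run c s) m'.

Lemma reach_assign P pc x e s m : is_variable x -> expr_fits stack e -> safe_expr s e ->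
  code_at P pc (compile_assign x e) -> represents s m ->
  exists2 m', reach P (130 * n) (expr_cost e + 2)
                (pc, m) (pc + size (compile_assign x e), m') &
    represents (set_var s x (eval s e)) m'.
Proof.
move=> vx fits_e safe_e code repr_m; move: (vx); rewrite /is_variable => x16.
have [fits m1_stack same] := compile_exprP (leqnn stack) fits_e safe_e repr_m.
set m1 := run_block _ m in fits m1_stack same.
exists (run_block (compile_assign x e) m).
  rewrite -(size_compile_assign x); apply: (reach_block code).
  by rewrite block_fits_cat fits /= /touched /=; lia.
rewrite run_block_cat /= /effect /= -/m1; simpl_upd; rewrite m1_stack Z.add_0_r.
apply: represents_set_var => //.
by apply: (represents_same_below (leqnn stack)) repr_m => y y16; simpl_upd; exact: same.
Qed.

Lemma reach_put P pc a i e s m : expr_fits stack e -> expr_fits stack.+1 i ->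
  safe_expr s i -> safe_expr s e -> valid_cell a (eval s i) ->
  code_at P pc (compile_put a i e) -> represents s m ->
  exists2 m', reach P (130 * n) (expr_cost i + expr_cost e + 4)
                (pc, m) (pc + size (compile_put a i e), m') &
    represents (set_cell s a (eval s i) (eval s e)) m'.
Proof.
move=> fits_e fits_i safe_i safe_e ai code repr_m; have addr := address_bounds ai.
have [fits1 m1_value same1] := compile_exprP (leqnn stack) fits_e safe_e repr_m.
set m1 := run_block _ m in fits1 m1_value same1.
have repr_m1 : represents s m1 by apply: represents_same_below same1 repr_m.
have [fits2 m2_address same2] :
    computes stack.+1 (compile_expr stack.+1 i ++ compile_address stack.+1 a)
      (address a (eval s i)) m1.
  apply: (computes_cat (leqnn _) (compile_exprP (leqnSn stack) fits_i safe_i repr_m1)).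
  move=> m' m'_index same'; apply: computes_address => //.
  by have [] := represents_same_below (leqnSn stack) same' repr_m1.
set m2 := run_block _ m1 in fits2 m2_address same2.
exists (run_block (compile_put a i e) m).
  rewrite -(size_compile_put a); apply: (reach_block code).
  rewrite !block_fits_cat fits1 -/m1 -block_fits_cat fits2.
  by rewrite -/m2 /= /touched /= m2_address Nat2Z.id; lia.
rewrite run_block_cat -/m1 run_block_cat -/m2 /= /effect /= m2_address Nat2Z.id same2 //.
rewrite m1_value; apply: represents_set_cell => //.
exact: represents_same_below same2 repr_m1.
Qed.

Lemma reach_test P pc x hi body exit s m :
  is_variable x -> expr_fits stack hi -> safe_expr s hi ->
  code_at P pc (compile_test x hi body exit) -> represents s m ->
  let continue := var s x < eval s hi in
  exists2 m', reach P (130 * n) (expr_cost hi + (if continue then 2 else 3))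
                (pc, m) (if continue then body else exit, m') &
    represents s m'.
Proof.
move=> vx fits_hi safe_hi code repr_m continue; move: (vx); rewrite /is_variable => x16.
have [fits m1_hi same] := compile_exprP (leqnn stack) fits_hi safe_hi repr_m.
set m1 := run_block _ m in fits m1_hi same.
have [_ m1_var _] : represents s m1 by apply: represents_same_below same repr_m.
have [{}code /code_at_cons[sub /code_at_cons[jneg /code_at_cons[jmp _]]]] :=
  code_at_cat code.
have reach_hi := reach_block code fits.
rewrite -/m1 size_compile_expr in reach_hi sub jneg jmp.
set next := pc + _ in reach_hi sub jneg jmp.
pose m2 := upd m1 stack (Z.of_nat (var s x) - Z.of_nat (eval s hi)).
have reach_sub : reach P (130 * n) 1 (next, m1) (next.+1, m2).
  by apply: reach_step; rewrite /= sub; [lia | rewrite m1_hi m1_var].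
have reach_jneg :
    reach P (130 * n) 1 (next.+1, m2) (if continue then body else next.+2, m2).
  apply: reach_step; rewrite /= jneg; first lia.
  by rewrite /m2 upd_same /continue; case: Z.ltb_spec; case: ltnP => // *; lia.
exists m2; last first.
  apply: (represents_same_below (leqnn stack)) repr_m => y y16.
  by rewrite /m2; simpl_upd; exact: same.
have := reach_trans reach_hi (reach_trans reach_sub reach_jneg).
case: (continue) => // reach_jmp; rewrite -[3]/(2 + 1) addnA.
by apply: reach_trans reach_jmp _; apply: reach_step; rewrite /= jmp.
Qed.

Lemma reach_incr P pc x start s m : is_variable x ->
  code_at P pc (compile_incr x start) -> represents s m ->
  exists2 m', reach P (130 * n) 3 (pc, m) (start, m') & represents (incr x s) m'.
Proof.
move=> vx code repr_m; move: (vx); rewrite /is_variable => x16.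
have [_ m_var _] := repr_m.
have [{}code /code_at_cons[jmp _]] :=
  @code_at_cat P pc [:: IConst stack 1; IAdd x x stack] [:: IJmp start] code.
set m1 := upd (upd m stack 1%Z) x (Z.of_nat (var s x).+1).
have reach_add : reach P (130 * n) 2 (pc, m) (pc + 2, m1).
  have -> : m1 = run_block [:: IConst stack 1; IAdd x x stack] m.
    by rewrite /= /effect /=; simpl_upd; rewrite m_var //; congr (upd _ _ _); lia.
  by apply: (reach_block code); rewrite /= /touched /=; lia.
exists m1; first by apply: (reach_trans reach_add); apply: reach_step; rewrite /= jmp.
apply: represents_set_var => //.
by apply: (represents_same_below (leqnn stack)) repr_m; exact: same_below_upd.
Qed.

Lemma simulates_for x lo hi b s :
  cmd_fits (For x lo hi b) -> safe (For x lo hi b) s ->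
  (forall i, i < eval s hi - eval s lo -> simulates b (loop_state x lo b s i)) ->
  simulates (For x lo hi b) s.
Proof.
move=> /and5P[vx fits_lo fits_hi _ /andP[x_hi /andP[x_b hi_b]]] [safe_lo safe_hi _] sim_b.
set N := eval s hi - eval s lo; move=> P pc m /=.
set start := pc + _; set body := start + _; set exit := body + _.
move=> /code_at_cat[code_lo]; rewrite size_compile_assign -/start.
move=> /code_at_cat[code_test]; rewrite size_compile_test -/body.
move=> /code_at_cat[code_b code_incr] repr_m.
have agree_hi i : {in reads hi, forall l, loop_state x lo b s i l =1 s l}.
  move=> l lhi; apply: (@loop_state_agree_off x lo b s i (@run_agree_off b)).
  rewrite inE negb_or; apply/andP; split; last exact: (allP hi_b).
  by apply: contraNneq x_hi => <-.
have [m0 reach_m0 repr_m0] := reach_assign vx fits_lo safe_lo code_lo repr_m.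
have test i m' : represents (loop_state x lo b s i) m' -> exists2 m'',
    reach P (130 * n) (expr_cost hi + (if i < N then 2 else 3))
      (start, m') (if i < N then body else exit, m'') &
    represents (loop_state x lo b s i) m''.
  move=> repr_i; have := reach_test vx fits_hi _ code_test repr_i.
  rewrite (safe_expr_agree (agree_hi i)) (eval_agree (agree_hi i)) loop_state_index //.
  by rewrite -ltn_subRL => /(_ safe_hi).
have [i m' iN repr_i|m' repr_N|m1 reach_m1 repr_m1] := @reach_loop P (130 * n) start exit
  N (fun i => expr_cost hi + 2 + (cost b (loop_state x lo b s i) + 3)) (expr_cost hi + 3)
  (fun i => represents (loop_state x lo b s i)) (represents (loop_state x lo b s N))
  _ _ m0 repr_m0.
- have [m2] := test i m' repr_i; rewrite iN => reach_m2 repr_m2.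
  have [m3 reach_m3 repr_m3] := sim_b i iN P body m2 code_b repr_m2.
  have [m4 reach_m4 repr_m4] := reach_incr vx code_incr repr_m3.
  by exists m4 => //; exact: reach_trans reach_m2 (reach_trans reach_m3 reach_m4).
- by have [m1] := test N m' repr_N; rewrite ltnn; exists m1.
rewrite size_compile_assign in reach_m0; exists m1 => //.
rewrite size_cat size_compile_assign size_cat size_compile_test size_cat.
rewrite (_ : pc + _ = exit); last by rewrite /exit /body !addnA.
exact: reach_trans reach_m0 reach_m1.
Qed.

Lemma compileP c s : cmd_fits c -> safe c s -> simulates c s.
Proof.
elim: c s => [x e|a i e|c1 IH1 c2 IH2|x lo hi b IHb] s.
- by move=> /andP[vx fits_e] safe_e P pc m; exact: reach_assign.
- by move=> /andP[fits_e fits_i] /and3P[safe_i safe_e ai] P pc m; exact: reach_put.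
- move=> /andP[fits1 fits2] [safe1 safe2] P pc m /= /code_at_cat[code1 code2] repr_m.
  have [m1 reach1 repr_m1] := IH1 s fits1 safe1 P pc m code1 repr_m.
  have [m2 reach2 repr_m2] := IH2 _ fits2 safe2 P _ m1 code2 repr_m1.
  by exists m2 => //; rewrite size_cat addnA; exact: reach_trans reach1 reach2.
move=> fits_for safe_for; apply: simulates_for => // i iN.
by apply: IHb; [case/and5P: fits_for | case: safe_for => _ _; exact].
Qed.

End Compilation.

(** * Total correctness within a time bound *)

Definition wp (n : nat) (c : cmd) (T : nat) (Q : store -> Prop) (s : store) : Prop :=
  [/\ safe n c s, cost c s <= T & Q (run c s)].

Lemma wp_weaken n c T (Q Q' : store -> Prop) s :
  wp n c T Q s -> (forall s', Q s' -> Q' s') -> wp n c T Q' s.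
Proof. by move=> [safe_c cost_c Q_c] QQ; split=> //; exact: QQ. Qed.

Lemma wp_time n c T T' (Q : store -> Prop) s : wp n c T Q s -> T <= T' -> wp n c T' Q s.
Proof. by move=> [safe_c cost_c Q_c] TT; split=> //; exact: leq_trans TT. Qed.

Lemma wp_assign n x e (Q : store -> Prop) s : safe_expr n s e ->
  Q (set_var s x (eval s e)) -> wp n (Assign x e) (expr_cost e + 2) Q s.
Proof. by split. Qed.

Lemma wp_put n a i e (Q : store -> Prop) s :
  [&& safe_expr n s i, safe_expr n s e & valid_cell n a (eval s i)] ->
  Q (set_cell s a (eval s i) (eval s e)) ->
  wp n (Put a i e) (expr_cost i + expr_cost e + 4) Q s.
Proof. by split. Qed.

Lemma wp_seq n c1 c2 T1 T2 (Q : store -> Prop) s :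
  wp n c1 T1 (fun s' => agree_off (writes c1) s s' -> wp n c2 T2 Q s') s ->
  wp n (Seq c1 c2) (T1 + T2) Q s.
Proof.
move=> [safe1 cost1 /(_ (run_agree_off _))[safe2 cost2 Q_c]]; split=> //=.
exact: leq_add.
Qed.

Lemma wp_for (I : nat -> store -> Prop) n x lo hi b T (Q : store -> Prop) s :
  inl x \notin writes b -> safe_expr n s lo -> safe_expr n s hi ->
  I (eval s lo) (set_var s x (eval s lo)) ->
  (forall i s', eval s lo <= i < eval s hi -> agree_off (inl x :: writes b) s s' ->
     var s' x = i -> I i s' -> wp n b T (fun s'' => I i.+1 (incr x s'')) s') ->
  (forall s', I (maxn (eval s lo) (eval s hi)) s' -> Q s') ->
  wp n (For x lo hi b)
    (expr_cost lo + expr_cost hi + 5 + (eval s hi - eval s lo) * (T + expr_cost hi + 5))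
    Q s.
Proof.
move=> x_b safe_lo safe_hi I_lo I_b I_Q; set N := eval s hi - eval s lo.
have wp_b i : i < N -> I (eval s lo + i) (loop_state x lo b s i) ->
    wp n b T (fun s' => I (eval s lo + i.+1) (incr x s')) (loop_state x lo b s i).
  move=> iN I_i; rewrite addnS; apply: I_b I_i; first lia.
    by apply: loop_state_agree_off; exact: run_agree_off.
  exact: loop_state_index.
have I_loop i : i <= N -> I (eval s lo + i) (loop_state x lo b s i).
  elim: i => [|i IH] iN; first by rewrite addn0.
  by have [] := wp_b i iN (IH (ltnW iN)).
split; rewrite /= -?/N.
- by split=> // i iN; have [] := wp_b i iN (I_loop i (ltnW iN)).
- have iterations :
      \sum_(0 <= i < N) (expr_cost hi + 2 + (cost b (loop_state x lo b s i) + 3)) <=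
      N * (T + expr_cost hi + 5).
    rewrite -[X in X * _]subn0 -sum_nat_const_nat !big_nat; apply: leq_sum => i iN.
    by have [_ cost_b _] := wp_b i iN (I_loop i (ltnW iN)); lia.
  by move: (N * _) iterations => bound; lia.
- by apply: I_Q; rewrite maxnE; exact: I_loop.
Qed.

(** * The ranking program *)

Declare Scope expr_scope.
Delimit Scope expr_scope with E.
Bind Scope expr_scope with expr.
Local Coercion Cst : nat >-> expr.
Local Notation "$ x" := (Var x) (at level 1, format "$ x") : expr_scope.
Local Notation "a .[ e ]" := (Get a e) : expr_scope.
Local Notation "e + f" := (Bin Plus e f) : expr_scope.
Local Notation "e - f" := (Bin Minus e f) : expr_scope.
Local Notation "e * f" := (Bin Times e f) : expr_scope.
Local Notation "e / f" := (Bin Quot e f) : expr_scope.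
Local Notation "x <- e" := (Assign x e) (at level 90).
Local Notation "a [ i ] <- e" := (Put a i e) (at level 90).
Local Notation "c1 ;; c2" := (Seq c1 c2) (at level 100, right associativity).

Local Notation vk := 0 (only parsing).
Local Notation vn := 1 (only parsing).
Local Notation vi := 3 (only parsing).
Local Notation vd := 4 (only parsing).
Local Notation vlen := 5 (only parsing).
Local Notation vj := 6 (only parsing).
Local Notation vacc := 7 (only parsing).
Local Notation vtotal := 8 (only parsing).

Local Notation input := 0 (only parsing).
Local Notation letters := 1 (only parsing).
Local Notation values := 2 (only parsing).
Local Notation powers := 3 (only parsing).
Local Notation counts := 4 (only parsing).

Definition min_expr (e f : expr) : expr := (e - (e - f))%E.
Definition max_expr (e f : expr) : expr := (e + (f - e))%E.
Definition eq_expr (e f : expr) : expr := (1 - ((e - f) + (f - e)))%E.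

Definition completions_expr : expr :=
  let size_p := ($vi + 1)%E in
  let start := ($vlen - $vj)%E in
  let stop := min_expr ($vlen) size_p in
  Cond (size_p - start)
    (eq_expr (values.[stop])
       (values.[start] * powers.[stop - start] + values.[stop - start]))
    (powers.[start - max_expr size_p ($vj)]).

Definition count_step : cmd :=
  vacc <- powers.[$vlen - ($vi + 1)];;
  For vj 1 ($vlen / 2 + 1)
    (vacc <- $vacc - counts.[$vj] * completions_expr);;
  counts[$vlen] <- $vacc.

Definition count_code : cmd := For vlen 1 ($vn + 1) count_step.

Definition digit_step : cmd :=
  values[$vi + 1] <- values.[$vi] * $vk + $vd;;
  count_code;;
  vtotal <- $vtotal + counts.[$vn].

Definition letter_step : cmd :=
  For vd 0 (letters.[$vi] - 1) digit_step;;
  values[$vi + 1] <- values.[$vi] * $vk + (letters.[$vi] - 1).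

(* The first 30 letters lie in registers 2, ..., 31, and [prologue] moves them. *)
Definition copy_letters : cmd := For vi 30 ($vn) (letters[$vi] <- input.[$vi + 2]).

Definition tabulate_powers : cmd :=
  powers[0] <- 1;;
  For vi 0 ($vn) (powers[$vi + 1] <- powers.[$vi] * $vk).

Definition scan_letters : cmd :=
  values[0] <- 0;;
  vtotal <- 0;;
  For vi 0 ($vn) letter_step.

Definition rank_code : cmd :=
  copy_letters;;
  tabulate_powers;;
  scan_letters;;
  vk <- values.[$vn] - $vtotal + 1.

Lemma rank_code_fits : cmd_fits rank_code.
Proof. by []. Qed.

Definition stored_prefix (k n : nat) (p : seq nat) (s : store) : Prop :=
  [/\ var s vn = n, (var s vi).+1 = size p,
      forall l, l <= n -> cell s powers l = k ^ l &
      forall l, l <= size p -> cell s values l = digits_val k (take l p)].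

Lemma stored_prefix_agree L k n p s s' : agree_off L s s' ->
  all [predC L] [:: inl vn; inl vi; inr powers; inr values] ->
  stored_prefix k n p s -> stored_prefix k n p s'.
Proof.
move=> agree /and5P[n_L i_L pow_L val_L _] [s_n s_i s_pow s_val].
split; [by rewrite agree | by rewrite agree | |] => l l_le; rewrite agree //.
  exact: s_pow.
exact: s_val.
Qed.

Lemma eqn_subn x y : (x == y) = 1 - ((x - y) + (y - x)) :> nat.
Proof. by case: eqP; lia. Qed.

Lemma safe_completions n s : (var s vi).+1 <= n -> var s vlen <= n ->
  safe_expr n s completions_expr.
Proof. by move=> i_n len_n; rewrite /= /valid_cell; lia. Qed.

Lemma eval_completions k n p N j s : all (ltn^~ k) p -> stored_prefix k n p s ->
  var s vlen = N -> var s vj = j -> j + j <= N <= n ->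
  eval s completions_expr = border_completions k p N j.
Proof.
move=> kp [_ s_i s_pow s_val] s_len s_j jN; rewrite /border_completions.
rewrite /= s_len s_j addn1 s_i -minnE -maxnE subn_gt0; case: ltnP => overlap; last first.
  by rewrite s_pow //; lia.
rewrite (compat_drop_take_digits_val kp); last lia.
by rewrite subnK ?s_val ?s_pow ?eqn_subn //; lia.
Qed.

Lemma wp_count_step k n p N s : all (ltn^~ k) p -> size p <= n -> 0 < N <= n ->
  stored_prefix k n p s -> var s vlen = N ->
  (forall j, 0 < j < N -> cell s counts j = unbordered_count k p j) ->
  wp n count_step (300 * n)
    (fun s' => forall j, 0 < j <= N -> cell s' counts j = unbordered_count k p j) s.
Proof.
move=> kp pn /andP[N0 Nn] prefix_s s_len s_counts; have [_ s_i s_pow _] := prefix_s.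
pose bordered_count j :=
  \sum_(1 <= l < j) unbordered_count k p l * border_completions k p N l.
eapply wp_time; [apply: wp_seq; apply: wp_assign => [|agree1]|].
- by rewrite /= /valid_cell; lia.
- set s1 := set _ _ _ _ in agree1 *.
  have prefix_s1 := stored_prefix_agree agree1 isT prefix_s.
  have s1_acc : var s1 vacc = k ^ (N - size p).
    by rewrite /s1 /set /= s_len addn1 s_i s_pow //; lia.
  have s1_len : var s1 vlen = N by rewrite agree1.
  apply: wp_seq; apply: (wp_for
    (I := fun j s' => var s' vacc = k ^ (N - size p) - bordered_count j)) => //=.
  + by rewrite /set /= -/s1 s1_acc /bordered_count big_geq ?subn0.
  + rewrite -/s1 s1_len => j s2 j_half agree2 s2_j s2_acc.
    have prefix_s2 := stored_prefix_agree agree2 isT prefix_s1.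
    have [_ s2_i _ _] := prefix_s2.
    have s2_len : var s2 vlen = N by rewrite agree2.
    apply: wp_assign.
      apply/and3P; split=> //; last by apply: safe_completions; lia.
      by rewrite /= /valid_cell; lia.
    have -> : eval s2 ($vacc - counts.[$vj] * completions_expr) =
        var s2 vacc - cell s2 counts (var s2 vj) * eval s2 completions_expr by [].
    rewrite (eval_completions kp prefix_s2 s2_len s2_j); last lia.
    rewrite s2_acc s2_j agree2 // agree1 // s_counts; last lia.
    by rewrite /incr /set /= /bordered_count big_nat_recr ?subnDA //=; lia.
  + rewrite -/s1 s1_len => s2 s2_acc agree2.
    apply: wp_put => [|j j_N]; rewrite /= agree2 // s1_len.
      by rewrite /valid_cell; lia.
    rewrite /set /=; case: eqP => [->|jN].
      have := unbordered_count_rec N kp.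
      by rewrite s2_acc /bordered_count -divn2 (maxn_idPr _) ?addn1 //; lia.
    by rewrite agree2 // agree1 // s_counts //; lia.
- by rewrite /expr_cost /set /= s_len; lia.
Qed.

Lemma wp_count_code k n p s : 0 < n -> all (ltn^~ k) p -> size p <= n ->
  stored_prefix k n p s ->
  wp n count_code (400 * n ^ 2)
    (fun s' => cell s' counts n = unbordered_count k p n) s.
Proof.
move=> n0 kp pn prefix_s; have [s_n _ _ _] := prefix_s.
eapply wp_time; [apply: (wp_for (I := fun N s' =>
  forall j, 0 < j < N -> cell s' counts j = unbordered_count k p j)) => //|].
- by move=> j; rewrite /=; lia.
- move=> N s'; rewrite /= s_n => N_n agree s'_len s'_counts.
  have prefix_s' := stored_prefix_agree agree isT prefix_s.
  by apply: (wp_weaken (wp_count_step kp pn _ prefix_s' s'_len s'_counts)) => //; lia.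
- by move=> s' s'_counts; apply: s'_counts; rewrite /= s_n; lia.
- by rewrite /expr_cost /= s_n; nia.
Qed.

Definition loaded_word (k : nat) (u : seq nat) (s : store) : Prop :=
  [/\ var s vn = size u, var s vk = k &
      forall l, l < size u -> cell s letters l = (nth 0 u l).+1].

Definition scanned_letters (k : nat) (u : seq nat) (i : nat) (s : store) : Prop :=
  [/\ loaded_word k u s,
      forall l, l <= size u -> cell s powers l = k ^ l &
      forall l, l <= i -> cell s values l = digits_val k (take l u)].

Lemma scanned_letters_agree L k u i s s' : agree_off L s s' ->
  all [predC L] [:: inl vn; inl vk; inr powers; inr letters; inr values] ->
  scanned_letters k u i s -> scanned_letters k u i s'.
Proof.
move=> agree /and5P[n_L k_L pow_L let_L /andP[val_L _]] [[s_n s_k s_let] s_pow s_val].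
split=> [|l l_le|l l_le]; last 2 first.
- by rewrite agree ?s_pow.
- by rewrite agree ?s_val.
by split=> [||l l_lt]; rewrite agree ?s_let.
Qed.

Lemma scanned_letters_set_var k u i s x v : x \notin [:: vn; vk] ->
  scanned_letters k u i s -> scanned_letters k u i (set_var s x v).
Proof.
rewrite !inE negb_or => /andP[x_n x_k]; apply: (@scanned_letters_agree [:: inl x]).
  by apply: agree_off_set; rewrite inE.
by apply/and5P; split=> //; rewrite /= inE eq_sym.
Qed.

Lemma scanned_letters_set_cell k u i v s : scanned_letters k u i s ->
  scanned_letters k u i (set_cell s values i.+1 v).
Proof.
move=> [loaded s_pow s_val]; split=> // l li.
by rewrite /set /= ltn_eqF ?s_val //; lia.
Qed.

Lemma scanned_letters_recl k u i s : i < size u -> scanned_letters k u i s ->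
  cell s values i.+1 = digits_val k (take i u) * k + nth 0 u i ->
  scanned_letters k u i.+1 s.
Proof.
move=> iu [loaded s_pow s_val] s_i; split=> // l.
rewrite leq_eqVlt => /predU1P[->|li]; last exact: s_val.
by rewrite s_i (take_nth 0) // digits_val_rcons.
Qed.

Lemma stored_prefix_rcons k u i d s : i < size u -> var s vi = i ->
  scanned_letters k u i s ->
  cell s values i.+1 = digits_val k (take i u) * k + d ->
  stored_prefix k (size u) (rcons (take i u) d) s.
Proof.
move=> iu s_i [[s_n _ _] s_pow s_val] s_d.
have size_p : size (rcons (take i u) d) = i.+1 by rewrite size_rcons size_takel // ltnW.
split=> //; rewrite ?s_i size_p // => l; rewrite leq_eqVlt => /predU1P[->|li].
  by rewrite -{2}size_p take_size digits_val_rcons.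
by rewrite s_val // -cats1 takel_cat ?take_takel // size_takel // ltnW.
Qed.

Lemma wp_digit_step k u i d s : all (ltn^~ k) u -> i < size u -> d < k ->
  scanned_letters k u i s -> var s vi = i -> var s vd = d ->
  wp (size u) digit_step (500 * size u ^ 2)
    (fun s' => scanned_letters k u i s' /\
       var s' vtotal = var s vtotal + unbordered_count k (rcons (take i u) d) (size u)) s.
Proof.
move=> ku iu dk scanned_s s_i s_d; have [[s_n s_k _] _ s_val] := scanned_s.
set n := size u; set p := rcons (take i u) d.
have size_p : size p = i.+1 by rewrite size_rcons size_takel // ltnW.
have kp : all (ltn^~ k) p by rewrite all_rcons all_take // andbT.
eapply wp_time; [apply: wp_seq; apply: wp_put => [|agree1]|].
- by rewrite /= /valid_cell s_i -/n; lia.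
- rewrite [eval s _]/= s_i addn1 [eval s _]/= s_i s_val // s_k s_d in agree1 *.
  set s1 := set_cell s values i.+1 _ in agree1 *.
  have scanned_s1 : scanned_letters k u i s1 by exact: scanned_letters_set_cell.
  have prefix_s1 : stored_prefix k n p s1.
    by apply: stored_prefix_rcons => //; rewrite /s1 /set !eqxx.
  apply: wp_seq; apply: (wp_weaken (wp_count_code _ kp _ prefix_s1));
    try by rewrite ?size_p; lia.
  move=> s2 s2_count agree2.
  have scanned_s2 := scanned_letters_agree agree2 isT scanned_s1.
  have [[s2_n _ _] _ _] := scanned_s2.
  apply: wp_assign; first by rewrite /= /valid_cell s2_n -/n; lia.
  split; first exact: scanned_letters_set_var.
  by rewrite /set /= s2_n s2_count agree2.
- by rewrite /expr_cost /=; nia.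
Qed.

Lemma wp_letter_step k u i s : all (ltn^~ k) u -> i < size u ->
  scanned_letters k u i s -> var s vi = i ->
  wp (size u) letter_step (600 * (k * size u ^ 2))
    (fun s' => scanned_letters k u i.+1 s' /\
       var s' vtotal = var s vtotal +
         \sum_(0 <= d < nth 0 u i) unbordered_count k (rcons (take i u) d) (size u)) s.
Proof.
move=> ku iu scanned_s s_i; have [[_ _ s_let] _ _] := scanned_s.
set n := size u; pose count d := unbordered_count k (rcons (take i u) d) n.
have uik : nth 0 u i < k by apply: (allP ku); rewrite mem_nth.
have eval_letter : eval s (letters.[$vi] - 1) = nth 0 u i.
  by rewrite /= s_i s_let // subn1.
eapply wp_time; [apply: wp_seq; apply: (wp_for (I := fun d s' =>
  scanned_letters k u i s' /\
  var s' vtotal = var s vtotal + \sum_(0 <= d' < d) count d')) => //|].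
- by rewrite /= /valid_cell s_i -/n; lia.
- by split; [exact: scanned_letters_set_var | rewrite big_geq ?addn0].
- rewrite eval_letter => d s' d_lt agree s'_d [scanned_s' s'_total].
  have s'_i : var s' vi = i by rewrite agree.
  have dk : d < k by lia.
  apply: (wp_weaken (wp_digit_step ku iu dk scanned_s' s'_i s'_d)).
  move=> s'' [scanned_s'' s''_total]; split; first exact: scanned_letters_set_var.
  by rewrite /incr /set /= s''_total s'_total big_nat_recr //= addnA.
- rewrite eval_letter max0n => s1 [scanned_s1 s1_total] agree1.
  have [[_ s1_k s1_let] _ s1_val] := scanned_s1.
  have s1_i : var s1 vi = i by rewrite agree1.
  apply: wp_put; first by rewrite /= /valid_cell s1_i -/n; lia.
  split=> //; rewrite [eval s1 _]/= s1_i addn1.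
  apply: scanned_letters_recl => //; first exact: scanned_letters_set_cell.
  by rewrite /set !eqxx /= s1_i s1_val // s1_k s1_let // subn1.
- by rewrite eval_letter /expr_cost /=; nia.
Qed.

Lemma wp_copy_letters k u s : var s vn = size u -> var s vk = k ->
  (forall l, l < size u -> l < 30 -> cell s letters l = (nth 0 u l).+1) ->
  (forall l, l < size u -> 30 <= l -> cell s input l.+2 = (nth 0 u l).+1) ->
  wp (size u) copy_letters (50 * size u + 50) (loaded_word k u) s.
Proof.
move=> s_n s_k s_let s_input.
eapply wp_time; [apply: (wp_for (I := fun i s' => [/\ var s' vn = size u, var s' vk = k &
  forall l, l < size u -> l < i -> cell s' letters l = (nth 0 u l).+1])) => //|].
- move=> i s'; rewrite /= s_n => i_u agree s'_i [s'_n s'_k s'_let].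
  apply: wp_put; first by rewrite /= /valid_cell s'_i; lia.
  split=> // l lu li; rewrite /incr /set /= s'_i agree // addn2.
  by case: eqP => [->|il]; [apply: s_input | apply: s'_let]; lia.
- by move=> s' [s'_n s'_k s'_let]; split=> // l lu; apply: s'_let => //=; lia.
- by rewrite /expr_cost /= s_n; nia.
Qed.

Lemma wp_tabulate_powers k u s : loaded_word k u s ->
  wp (size u) tabulate_powers (50 * size u + 50)
    (fun s' => loaded_word k u s' /\ forall l, l <= size u -> cell s' powers l = k ^ l) s.
Proof.
move=> [s_n s_k s_let]; eapply wp_time; [apply: wp_seq; apply: wp_put => // _|].
set s1 := set _ _ _ _; have s1_n : var s1 vn = size u by [].
apply: (wp_for (I := fun i s' => loaded_word k u s' /\
    forall l, l <= i -> cell s' powers l = k ^ l)) => //.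
- by split=> // l; rewrite leqn0 => /eqP ->.
- move=> i s'; rewrite /= s1_n => i_u agree s'_i [[s'_n s'_k s'_let] s'_pow].
  apply: wp_put; first by rewrite /= /valid_cell s'_i; lia.
  split=> // l li; rewrite /incr /set /= s'_i addn1 s'_k.
  by case: eqP => [->|il]; [rewrite s'_pow // expnSr | apply: s'_pow; lia].
- by move=> s'; rewrite /= s1_n max0n.
- by rewrite /expr_cost /= /set /= s_n; nia.
Qed.

Lemma wp_scan_letters k u s : 0 < k -> 0 < size u -> all (ltn^~ k) u ->
  loaded_word k u s -> (forall l, l <= size u -> cell s powers l = k ^ l) ->
  wp (size u) scan_letters (700 * (k * size u ^ 3))
    (fun s' => scanned_letters k u (size u) s' /\
       var s' vtotal = \sum_(0 <= i < size u) \sum_(0 <= d < nth 0 u i)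
         unbordered_count k (rcons (take i u) d) (size u)) s.
Proof.
move=> k0 n0 ku [s_n s_k s_let] s_pow.
eapply wp_time; [apply: wp_seq; apply: wp_put => // _|].
apply: wp_seq; apply: wp_assign => // _.
set s1 := set _ _ _ _; have s1_n : var s1 vn = size u by [].
apply: (wp_for (I := fun i s' => scanned_letters k u i s' /\
  var s' vtotal = \sum_(0 <= j < i) \sum_(0 <= d < nth 0 u j)
         unbordered_count k (rcons (take j u) d) (size u))) => //.
- split; last by rewrite big_geq.
  by split=> // l; rewrite leqn0 => /eqP ->; rewrite take0.
- move=> i s'; rewrite /= s1_n => i_u agree s'_i [scanned_s' s'_total].
  apply: (wp_weaken (wp_letter_step ku _ scanned_s' s'_i)) => //.
  move=> s'' [scanned_s'' s''_total]; split; first exact: scanned_letters_set_var.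
  by rewrite /incr /set /= s''_total s'_total big_nat_recr.
- by move=> s'; rewrite /= s1_n max0n.
- have kn2 : 0 < k * size u ^ 2 by rewrite muln_gt0 k0 expn_gt0 n0.
  have -> : k * size u ^ 3 = size u * (k * size u ^ 2) by rewrite mulnCA -expnS.
  by rewrite /expr_cost /= /set /= s_n; nia.
Qed.

Lemma wp_rank_code k u s : 0 < k -> 0 < size u -> all (ltn^~ k) u ->
  var s vn = size u -> var s vk = k ->
  (forall l, l < size u -> l < 30 -> cell s letters l = (nth 0 u l).+1) ->
  (forall l, l < size u -> 30 <= l -> cell s input l.+2 = (nth 0 u l).+1) ->
  wp (size u) rank_code (1000 * (k * size u ^ 3))
    (fun s' => var s' vk = rankB k (map succn u)) s.
Proof.
move=> k0 n0 ku s_n s_k s_let s_input.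
eapply wp_time; [apply: wp_seq|].
  apply: (wp_weaken (wp_copy_letters s_n s_k s_let s_input)) => s1 loaded_s1 _.
  apply: wp_seq; apply: (wp_weaken (wp_tabulate_powers loaded_s1)).
  move=> s2 [loaded_s2 s2_pow] _; apply: wp_seq.
  apply: (wp_weaken (wp_scan_letters k0 n0 ku loaded_s2 s2_pow)).
  move=> s3 [[[s3_n _ _] _ s3_val] s3_total] _.
  apply: wp_assign; first by rewrite /= /valid_cell s3_n; lia.
  rewrite /set /= s3_n s3_total s3_val // take_size addn1.
  exact/esym/rankB_unbordered_count.
have n_le : size u <= k * size u ^ 3.
  by rewrite (leq_trans _ (leq_pmull _ k0)) // -[X in X <= _]expn1 leq_pexp2l.
by rewrite /expr_cost /=; lia.
Qed.

(** * Loading the input *)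

Definition spill (first count : nat) : seq instr :=
  flatten [seq [:: IAdd 1 1 2; IStore 1 r] | r <- iota first count].

Definition restore_size : seq instr :=
  [:: IConst 3 29; ISub stride 1 3; IConst 3 32; IDiv vn stride 3].

(* The input occupies the registers of variables and of the evaluation stack.
   Doublings in register 1 yield the address 32 n, to which registers 2, ..., 31,
   the first 30 letters, are moved; then n is recomputed by division. *)
Definition prologue : seq instr :=
  nseq 5 (IAdd 1 1 1) ++ [:: IStore 1 2; IConst 2 1] ++ spill 3 29 ++ restore_size.

Lemma doublingsP S j a m : 0 < S -> m 1 = Z.of_nat a ->
  block_fits S (nseq j (IAdd 1 1 1)) m /\
  forall x, run_block (nseq j (IAdd 1 1 1)) m x =
    if x == 1 then Z.of_nat (2 ^ j * a) else m x.
Proof.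
move=> S0; elim: j a m => [|j IH] a m m_1.
  by split=> // x; case: eqP => [->|_] //=; rewrite mul1n.
have [|fits run_rest] := IH (2 * a) (effect (IAdd 1 1 1) m).
  by rewrite /effect /= upd_same m_1; lia.
split=> [|x]; first by rewrite /= fits S0.
rewrite /= run_rest; case: eqP => [_|/eqP x1]; first by rewrite mulnA expnSr.
by rewrite /effect /= upd_other.
Qed.

Lemma spillP S first count a m : 3 <= first -> first + count <= a ->
  a + count <= S -> m 1 = Z.of_nat a -> m 2 = 1%Z ->
  block_fits S (spill first count) m /\
  forall x, run_block (spill first count) m x =
    if x == 1 then Z.of_nat (a + count) else
    if a < x <= a + count then m (first + (x - a.+1)) else m x.
Proof.
elim: count first a m => [|count IH] first a m lo disjoint hi m_1 m_2.
  by split=> // x; case: eqP => [->|_] /=; rewrite ?addn0 //; case: ifP => //; lia.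
pose m' := upd (upd m 1 (Z.of_nat a.+1)) a.+1 (m first).
have after_add : effect (IAdd 1 1 2) m = upd m 1 (Z.of_nat a.+1).
  by rewrite /effect /= m_1 m_2; congr (upd _ _ _); lia.
have after_store : effect (IStore 1 first) (effect (IAdd 1 1 2) m) = m'.
  rewrite after_add -[LHS]/(upd _ (Z.to_nat (upd _ _ _ 1)) (upd _ _ _ first)).
  by rewrite upd_same Nat2Z.id upd_other //; lia.
have m'_1 : m' 1 = Z.of_nat a.+1 by rewrite /m'; simpl_upd.
have m'_2 : m' 2 = 1%Z by rewrite /m'; simpl_upd.
have [|||fits run_rest] := IH first.+1 a.+1 m' _ _ _ m'_1 m'_2; [lia..|].
rewrite -[spill _ _]/([:: IAdd 1 1 2, IStore 1 first & spill first.+1 count]).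
split=> [|x].
  apply/and3P; split=> //; first by rewrite /=; lia.
  apply/and3P; split; [by [] | rewrite after_add | by rewrite after_store].
  rewrite -[touched _ _]/(maxn 1 (maxn first (Z.to_nat (upd m 1 _ 1)))).
  by rewrite upd_same Nat2Z.id; lia.
rewrite /= after_store run_rest addnS addSn; case: eqP => // /eqP x1.
case: ifP => later; first by rewrite ifT /m'; simpl_upd; [congr m | ]; lia.
case: (eqVneq x a.+1) => [->|xa].
  by rewrite ifT /m' ?upd_same ?subnn ?addn0 //; lia.
by rewrite ifF /m'; simpl_upd => //; lia.
Qed.

Lemma run_restore_size n m : m 1 = Z.of_nat (32 * n + 29) ->
  forall x, run_block restore_size m x =
    if x == 1 then Z.of_nat n else if x == 2 then Z.of_nat (32 * n) else
    if x == 3 then 32%Z else m x.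
Proof.
move=> m_1 x; rewrite /= /effect /= /upd /= m_1.
have -> : (Z.of_nat (32 * n + 29) - 29)%Z = Z.of_nat (32 * n) by lia.
have -> : (Z.of_nat (32 * n) / 32)%Z = Z.of_nat n.
  by rewrite mulnC Nat2Z.inj_mul Z.div_mul.
by case: (eqVneq x 2) => [->|_] //; case: (x == 1); case: (x == 3).
Qed.

Lemma prologueP n m : 0 < n -> m 1 = Z.of_nat n ->
  block_fits (130 * n) prologue m /\
  forall x, run_block prologue m x =
    if x == 1 then Z.of_nat n else if x == 2 then Z.of_nat (32 * n) else
    if x == 3 then 32%Z else
    if 32 * n <= x < 32 * n + 30 then m (x - 32 * n).+2 else m x.
Proof.
move=> n0 m_1; have S0 : 0 < 130 * n by lia.
have [fits1 run1] := doublingsP 5 S0 m_1; set m1 := run_block _ m in fits1 run1.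
have m1_1 : m1 1 = Z.of_nat (32 * n) by rewrite run1.
pose m2 := upd (upd m1 (32 * n) (m 2)) 2 1%Z.
have run2 : run_block [:: IStore 1 2; IConst 2 1] m1 = m2.
  by rewrite /= /effect /= m1_1 Nat2Z.id (run1 2).
have m2_1 : m2 1 = Z.of_nat (32 * n) by rewrite /m2; simpl_upd.
have m2_2 : m2 2 = 1%Z by rewrite /m2; simpl_upd.
have [|||fits3 run3] := @spillP (130 * n) 3 29 _ m2 _ _ _ m2_1 m2_2; [lia..|].
set m3 := run_block _ m2 in fits3 run3.
have m3_1 : m3 1 = Z.of_nat (32 * n + 29) by rewrite run3.
split=> [|x].
  rewrite block_fits_cat fits1 -/m1 block_fits_cat run2 block_fits_cat fits3 -/m3.
  by rewrite /= m1_1 Nat2Z.id; lia.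
rewrite run_block_cat -/m1 run_block_cat run2 run_block_cat -/m3 (run_restore_size m3_1).
case: (eqVneq x 1) => // x1; case: (eqVneq x 2) => // x2; case: eqP => // _.
rewrite run3 (negbTE x1); case: ifP => spilled.
  rewrite ifT; last lia.
  by rewrite /m2; simpl_upd; rewrite run1 /=; congr m; lia.
rewrite /m2 upd_other //; case: (eqVneq x (32 * n)) => [->|xn].
  by rewrite upd_same ifT ?subnn //; lia.
by rewrite upd_other // run1 (negbTE x1) ifF //; lia.
Qed.

Definition store_of (n : nat) (m : memory) : store := fun l i =>
  match l with
  | inl x => Z.to_nat (m x)
  | inr a => Z.to_nat (m (address n a i))
  end.

Lemma represents_store_of n m : (forall x, (0 <= m x)%Z) ->
  m stride = Z.of_nat (32 * n) -> represents n (store_of n m) m.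
Proof. by move=> m_ge0 m_stride; split=> // *; rewrite /= Z2Nat.id. Qed.

Lemma init_mem_ge0 k w x : (0 <= init_mem k w x)%Z.
Proof. by case: x => [|[|x]] /=; [lia | lia | case: ifP; lia]. Qed.

Lemma init_mem_letter k u l : l < size u ->
  init_mem k (map succn u) l.+2 = Z.of_nat (nth 0 u l).+1.
Proof. by move=> lu; rewrite /= size_map lu (nth_map 0). Qed.

Definition loaded_memory (k : nat) (w : seq nat) : memory :=
  run_block prologue (init_mem k w).

Lemma represents_loaded_memory k w : 0 < size w ->
  represents (size w) (store_of (size w) (loaded_memory k w)) (loaded_memory k w).
Proof.
move=> n0; have [_ run_prologue] := prologueP n0 (erefl : init_mem k w 1 = _).
apply: represents_store_of; rewrite /loaded_memory ?run_prologue // => x.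
rewrite run_prologue; have := @init_mem_ge0 k w x.
have := @init_mem_ge0 k w (x - 32 * size w).+2.
by do !case: ifP => _; lia.
Qed.

Lemma wp_rank_code_loaded k u : 0 < k -> 0 < size u -> all (ltn^~ k) u ->
  wp (size u) rank_code (1000 * (k * size u ^ 3))
    (fun s => var s vk = rankB k (map succn u))
    (store_of (size u) (loaded_memory k (map succn u))).
Proof.
move=> k0 n0 ku; set w := map succn u.
have input_n : init_mem k w 1 = Z.of_nat (size u) by rewrite /= size_map.
have [_ run_prologue] := prologueP n0 input_n.
apply: wp_rank_code => //; rewrite /store_of /loaded_memory.
- by rewrite run_prologue Nat2Z.id.
- by rewrite run_prologue /= ifF ?Nat2Z.id //; lia.
- move=> l lu l30; rewrite run_prologue /address muln1.
  do 3 (rewrite ifF; last lia).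
  by rewrite ifT ?addKn ?init_mem_letter ?Nat2Z.id //; lia.
- move=> l lu l30; rewrite run_prologue /address muln0 add0n.
  do 3 (rewrite ifF; last lia).
  by rewrite init_mem_letter ?Nat2Z.id.
Qed.

Definition rank_program : program := prologue ++ compile rank_code (size prologue).

Lemma rank_programP k u : 0 < k -> 0 < size u -> all (ltn^~ k) u ->
  exists t m, [/\ reach rank_program (130 * size u) t (init_config k (map succn u))
                    (size rank_program, m),
                  t <= 1100 * k * size u ^ 3 &
                  m 0 = Z.of_nat (rankB k (map succn u))].
Proof.
move=> k0 n0 ku; set w := map succn u.
have size_w : size w = size u by rewrite size_map.
have input_n : init_mem k w 1 = Z.of_nat (size u) by rewrite /= size_w.
have [fits _] := prologueP n0 input_n.
have [safe_rank cost_rank rank_k] := wp_rank_code_loaded k0 n0 ku.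
have [code1 code2] : code_at rank_program 0 prologue /\
    code_at rank_program (size prologue) (compile rank_code (size prologue)).
  exact: (@code_at_cat rank_program 0).
have loaded :
    represents (size u) (store_of (size u) (loaded_memory k w)) (loaded_memory k w).
  by rewrite -size_w; apply: represents_loaded_memory; rewrite size_w.
have [m reach_rank [_ m_var _]] := compileP n0 rank_code_fits safe_rank code2 loaded.
exists (size prologue + cost rank_code (store_of (size u) (loaded_memory k w))), m; split.
- by rewrite size_cat; exact: reach_trans (reach_block code1 fits) reach_rank.
- have kn3 : 0 < k * size u ^ 3 by rewrite muln_gt0 k0 expn_gt0 n0.
  rewrite (_ : 1100 * k * size u ^ 3 = 100 * (k * size u ^ 3) + 1000 * (k * size u ^ 3)).
    by apply: leq_add cost_rank; apply: leq_trans (leq_pmulr 100 kn3).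
  by rewrite -mulnA -mulnDl.
- by rewrite m_var // rank_k.
Qed.

Theorem theorem9 :
  exists (P : program) (C : nat),
    forall (n k : nat) (w : seq nat),
      (1 <= n)%N -> (2 <= k)%N -> size w = n -> word_over k w ->
      exists (t : nat) (cf : config) (mx : nat),
        exec P t (init_config k w) = Some (cf, mx) /\
        cf.2 0 = Z.of_nat (rankB k w) /\
        (t <= C * k * n ^ 3)%N /\
        (mx.+1 <= C * n)%N.
Proof.
exists rank_program, 1100 => n k w n0 k2 size_w kw; subst n.
pose u := map predn w.
have w_succ : w = map succn u.
  by rewrite -map_comp -[LHS]map_id; apply/eq_in_map => x /(allP kw) /=; lia.
have size_u : size u = size w by rewrite size_map.
have ku : all (ltn^~ k) u by rewrite all_map; apply: sub_all kw => x /=; lia.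
have u0 : 0 < size u by rewrite size_u.
have [t [m [reach_m t_le m_rank]]] := rank_programP (ltnW k2) u0 ku.
have [|mx mx_le exec_m] := reach_exec reach_m; first by rewrite /step nth_default.
exists t, (size rank_program, m), mx; rewrite {1 2}w_succ -size_u; split=> //; split=> //.
by split=> //; lia.
Qed.
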